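(* With $\xi=\xi_\gamma\xi_g\in\mathbb{R}Q_x^{\pm}=\mathrm{End}(4096_x)$, the $24\times 24$ matrix $\xi_{24}=\xi_{24a}\xi_{24b}$, and the groups $G(4096_x)$, $G(24_x)$, $G_{x0}$ defined in the context, one has $$\xi\in G(4096_x),\qquad \xi_{24}\in G(24_x),\qquad \xi\otimes\xi_{24}\in G_{x0}.$$
   Context: All groups act from the right. Golay code. Let $\mathbb{F}_4=\{0,1,\alpha,\bar\alpha\}$, $\alpha^2=\bar\alpha=1+\alpha$, and let $\mathcal{H}_6\subset\mathbb{F}_4^6$ be the $\mathbb{F}_4$-span of $(1,0,0,1,\bar\alpha,\alpha),(0,1,0,1,\alpha,\bar\alpha),(0,0,1,1,1,1)$. Let $\tilde\Omega=\{0,\dots,23\}$, arranged in an array (MOG) with rows $0,\dots,3$ and columns $0,\dots,5$, the element $m+4n$ being in row $m$, column $n$; rows $0,1,2,3$ carry labels $0,1,\alpha,\bar\alpha$. Subsets of $\tilde\Omega$ are identified with vectors in $\mathbb{F}_2^{24}$. For $x\in\mathbb{F}_2^{24}$, $\mathfrak h(x)\in\mathbb{F}_4^6$ has $n$-th coordinate the sum of the labels of the rows in which $x$ has an entry $1$ in column $n$. $\mathcal{C}$ is the set of $x$ with $\mathfrak h(x)\in\mathcal{H}_6$ such that the parity of $x$ in every column equals its parity in row $0$; it is a Golay code. $\mathcal{C}^*=\mathbb{F}_2^{24}/\mathcal{C}$, with pairing $\langle d,\delta\rangle=|d\cap\delta|\bmod 2$ on $\mathcal{C}\times\mathcal{C}^*$;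 subsets of $\tilde\Omega$ also denote their classes in $\mathcal{C}^*$. Grey and coloured parts. $\mathcal{G}\subset\mathcal{C}$: code words whose entries in rows 1,2,3 agree in each column. $\mathcal{H}\subset\mathcal{C}$: code words with zeros in row 0 and $0$ or $2$ ones in each column. $\mathcal{C}=\mathcal{G}\oplus\mathcal{H}$. $\mathcal{G}^*,\mathcal{H}^*\subset\mathcal{C}^*$ are the orthogonal complements of $\mathcal{H}$, $\mathcal{G}$. $\mathcal{G}$ has basis $g_0,\dots,g_5$, where $g_i$ has ones exactly in rows 1,2,3 of column $i$ and in row 0 of the columns $\ne i$. $\mathcal{G}^*$ has basis $\gamma_0,\dots,\gamma_5$, with $\gamma_i$ the class of the element in row 0, column $i$. $\omega=\sum_i\gamma_i$. $w$ is the weight (number of nonzero coefficients) with respect to these bases on $\mathcal{G}$ resp. $\mathcal{G}^*$, and $w_2=\binom{w}{2}\bmod 2$. $\gamma:\mathcal{C}\to\mathcal{G}^*$, $\gamma(d)$ = sum of those $\gamma_i$ for which $d$ has at least two ones in rows 1,2,3 of column $i$. Parker loop. $P(d)=\frac14|d|$, $C(d,e)=\frac12|d\cap e|$, $A(d,e,f)=|d\cap e\cap f|$ (mod 2); $A(d,e)\in\mathcal{C}^*$ is the class of $d\cap e$. Fix $\theta:\mathcal{C}\times\mathcal{C}\to\mathbb{F}_2$ with $\theta(d,d)=P(d)$, $\theta(d,e)+\theta(e,d)=C(d,e)$, $\theta(d+e,f)=\theta(d,f)+\theta(e,f)+A(d,e,f)$, $\theta(d,e+f)=\theta(d,e)+\theta(d,f)$;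 let $\theta(d)\in\mathcal{C}^*$ be given by $\langle e,\theta(d)\rangle=\theta(d,e)$. Moreover $\theta(d+\tilde\Omega)=\theta(d)$ for $d\in\mathcal{C}$; $\theta(e)=(w(e)-1)\gamma(e)+w_2(e)\omega$ for $e\in\mathcal{G}$; $\theta(e,h)=0$ and $\theta(h,e)=\langle e,\gamma(h)\rangle$ for $e\in\mathcal{G},h\in\mathcal{H}$. The Parker loop is $\mathcal{P}=\mathcal{C}\times\mathbb{F}_2$ with $(d,\lambda)(e,\mu)=(d+e,\lambda+\mu+\theta(d,e))$; $-1=(0,1)$, $\Omega=(\tilde\Omega,0)$. Functions on $\mathcal{C}$ are applied to $\mathcal{P}$ via projection. $Q_x$. $Q_x$ is the group of order $2^{25}$ generated by $x_d$ ($d\in\mathcal{P}$), $x_\delta$ ($\delta\in\mathcal{C}^*$) with $x=x_{-1}$ central and defining relations $x_d^2=x^{P(d)}$, $x_\delta^2=1$, $x_dx_e=x_{de}x_{A(d,e)}$, $x_\delta x_\epsilon=x_{\delta+\epsilon}$, $[x_d,x_\delta]=x^{\langle d,\delta\rangle}$. It is extraspecial of type $2_+^{1+24}$ with center $\{1,x_{-1}\}$. Put $\tilde x_d=x_{(d,0)}x_{\theta(d)}$ for $d\in\mathcal{C}$. $\mathbb{R}Q_x^\pm$ is the quotient of the group ring $\mathbb{R}Q_x$ obtained by identifying $x_{-1}$ with the scalar $-1$; $4096_x$ is the unique faithful irreducible real representation of $Q_x$ (dimension $4096$), with $\mathbb{R}Q_x^\pm\cong\mathrm{End}(4096_x)$,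 equipped with a $Q_x$-invariant Euclidean structure. Put $$\xi_\gamma=\tfrac18\sum_{\epsilon\in\mathcal{G}^*}(-1)^{w_2(\epsilon)}x_\epsilon,\quad \xi_g=\tfrac18\sum_{e\in\mathcal{G}}(-1)^{w_2(e)}\tilde x_e .$$ Leech lattice. In $\mathbb{R}^{24}$ with coordinates indexed by $\tilde\Omega$ and scalar product $\langle u,v\rangle=\frac18\sum u_iv_i$, $\Lambda$ is the set of $u$ for which there are $m\in\{0,1\}$, $d\in\mathcal{C}$ with $u_i\equiv m+2\langle d,i\rangle\pmod 4$ for all $i$ and $\sum u_i\equiv 4m\pmod 8$. There is an isomorphism $Q_x/\{1,x\}\to\Lambda/2\Lambda$ sending $x_i$ ($i\in\tilde\Omega$) to the class of $(-3$ on $i$, $1$ elsewhere$)$, and $x_d$ to the class of $(2$ on $d$, $0$ elsewhere$)$ if $|d|\equiv0\bmod 8$, and of $(0$ on $d$, $2$ elsewhere$)$ if $|d|\equiv4\bmod 8$. Groups. $24_x=\mathbb{R}^{24}$ and $G(24_x)=\mathrm{Aut}(\Lambda)=\mathrm{Co}_0$; $\mathrm{Co}_1=\mathrm{Co}_0/\{\pm1\}$ acts faithfully on $\Lambda/2\Lambda$. The standard holomorph $\mathfrak{H}(Q_x)$ (structure $2_+^{1+24}.\mathrm{O}_{24}^+(2)$) is the group of orthogonal transformations of $4096_x$ normalizing $Q_x$, and $G(4096_x)$ (structure $2_+^{1+24}.\mathrm{Co}_1$) is the subgroup of those elements whose conjugation action on $Q_x/\{1,x\}\cong\Lambda/2\Lambda$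 lies in $\mathrm{Co}_1$. $G_{x0}=\frac12(G(4096_x)\bigtriangleup_{\mathrm{Co}_1}G(24_x))$ is the group of pairs $(u,v)\in G(4096_x)\times G(24_x)$ with equal image in $\mathrm{Co}_1$, modulo $\{(1,1),(-1,-1)\}$; it is identified with the group of the transformations $u\otimes v$ of $4096_x\otimes24_x$. The matrices $\xi_{24a},\xi_{24b}$ act on $24_x$ by right multiplication on row vectors; each consists of six identical $4\times4$ blocks $\xi_{4a}$ resp. $\xi_{4b}$, one for each column of the MOG (rows $0,\dots,3$ in order), where $$\xi_{4a}=\frac12\begin{pmatrix}1&-1&-1&-1\\-1&1&-1&-1\\-1&-1&1&-1\\-1&-1&-1&1\end{pmatrix},\qquad \xi_{4b}=\mathrm{diag}(-1,1,1,1).$$ *)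

(* Defs.v *)
From HB Require Import structures.
From mathcomp Require Import all_boot all_order all_algebra all_fingroup.
From mathcomp Require Import generic_quotient ring_quotient mxrepresentation.
From mathcomp Require Import reals mxtens.

Set Implicit Arguments.
Unset Strict Implicit.
Unset Printing Implicit Defensive.

Import Order.TTheory GRing.Theory Num.Theory.
Local Open Scope ring_scope.

(* The field with four elements; MkF4 a b stands for a + b * alpha.           *)
Record F4 := MkF4 { F4re : 'F_2; F4im : 'F_2 }.

Definition F4_pair (x : F4) := (F4re x, F4im x).
Definition pair_F4 (p : 'F_2 * 'F_2) := MkF4 p.1 p.2.
Lemma F4_pairK : cancel F4_pair pair_F4. Proof. by case. Qed.
HB.instance Definition _ := Finite.copy F4 (can_type F4_pairK).

Lemma F2_ind (P : 'F_2 -> Prop) : P 0 -> P 1 -> forall a, P a.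
Proof.
by move=> P0 P1 [[|[|//]] lt_a2]; [move: P0|move: P1];
   congr P; apply: val_inj.
Qed.

Lemma F4_ind4 (P : F4 -> Prop) :
  P (MkF4 0 0) -> P (MkF4 1 0) -> P (MkF4 0 1) -> P (MkF4 1 1) ->
  forall x, P x.
Proof.
by move=> P00 P10 P01 P11 [a b]; elim/F2_ind: a; elim/F2_ind: b.
Qed.

Definition zeroF4 := MkF4 0 0.
Definition oneF4 := MkF4 1 0.
Definition alpha := MkF4 0 1.
Definition oppF4 (x : F4) := MkF4 (- F4re x) (- F4im x).
Definition addF4 (x y : F4) := MkF4 (F4re x + F4re y) (F4im x + F4im y).
(* (a + b alpha)(c + d alpha), reduced by alpha^2 = 1 + alpha *)
Definition mulF4 (x y : F4) :=
  MkF4 (F4re x * F4re y + F4im x * F4im y)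
       (F4re x * F4im y + F4im x * F4re y + F4im x * F4im y).
(* A nonzero element of F4 has norm 1, so its inverse is its conjugate.       *)
Definition invF4 (x : F4) := MkF4 (F4re x + F4im x) (F4im x).

Lemma addF4A : associative addF4.
Proof. by move=> x y z; rewrite /addF4 /= !addrA. Qed.
Lemma addF4C : commutative addF4.
Proof. by move=> x y; congr MkF4; apply: addrC. Qed.
Lemma add0F4 : left_id zeroF4 addF4.
Proof. by case=> a b; congr MkF4; apply: add0r. Qed.
Lemma addNF4 : left_inverse zeroF4 oppF4 addF4.
Proof. by case=> a b; congr MkF4; apply: addNr. Qed.
HB.instance Definition _ := GRing.isZmodule.Build F4
  addF4A addF4C add0F4 addNF4.

Lemma mulF4A : associative mulF4.
Proof.
by move=> x y z; apply/eqP; elim/F4_ind4: x; elim/F4_ind4: y; elim/F4_ind4: z.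
Qed.
Lemma mulF4C : commutative mulF4.
Proof. by move=> x y; apply/eqP; elim/F4_ind4: x; elim/F4_ind4: y. Qed.
Lemma mul1F4 : left_id oneF4 mulF4.
Proof. by move=> x; apply/eqP; elim/F4_ind4: x. Qed.
Lemma mulF4Dl : left_distributive mulF4 +%R.
Proof.
by move=> x y z; apply/eqP; elim/F4_ind4: x; elim/F4_ind4: y; elim/F4_ind4: z.
Qed.
Lemma oneF4_neq0 : oneF4 != 0. Proof. by []. Qed.
HB.instance Definition _ := GRing.Zmodule_isComNzRing.Build F4
  mulF4A mulF4C mul1F4 mulF4Dl oneF4_neq0.

Lemma mulVF4 (x : F4) : x != 0 -> invF4 x * x = 1.
Proof. by move=> nz_x; apply/eqP; move: nz_x; elim/F4_ind4: x. Qed.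
Lemma invF4_0 : invF4 0 = 0. Proof. by apply/eqP. Qed.
HB.instance Definition _ := GRing.ComNzRing_isField.Build F4 mulVF4 invF4_0.

Definition alphabar : F4 := 1 + alpha.

Definition hexacode_mx : 'M[F4]_(3, 6) :=
  \matrix_(i, j) (nth [::]
    [:: [:: 1; 0; 0; 1; alphabar; alpha];
        [:: 0; 1; 0; 1; alpha; alphabar];
        [:: 0; 0; 1; 1; 1; 1]] i)`_j.

(* The Miracle Octad Generator array: m is the row, n the column.             *)
Definition mog (m : 'I_4) (n : 'I_6) : 'I_24 := inord (m + 4 * n).
Definition mog_row (k : 'I_24) : 'I_4 := inord (k %% 4).
Definition mog_col (k : 'I_24) : 'I_6 := inord (k %/ 4).

Lemma mogE m n : mog m n = (m + 4 * n)%N :> nat.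
Proof.
rewrite inordK //; apply: (@leq_ltn_trans (3 + 4 * 5)) => //.
by rewrite leq_add ?leq_mul2l ?(leq_ord m) ?(leq_ord n).
Qed.

Lemma mog_rowK m n : mog_row (mog m n) = m.
Proof.
apply: val_inj; rewrite /= inordK ?ltn_mod // mogE addnC mulnC modnMDl.
by rewrite modn_small.
Qed.

Lemma mog_colK m n : mog_col (mog m n) = n.
Proof.
have mn : (mog m n %/ 4 = n)%N.
  by rewrite mogE addnC mulnC divnMDl // divn_small // addn0.
by apply: val_inj; rewrite /= inordK mn.
Qed.

Definition mog_label (m : 'I_4) : F4 := [:: 0; 1; alpha; alphabar]`_m.

(* Subsets of {0, ..., 23} are identified with their indicator vectors.       *)
Notation vec24 := 'rV['F_2]_24.

Definition card24 (x : vec24) : nat := #|[set i | x 0 i == 1]|.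
Definition meet24 (x y : vec24) : vec24 := \row_i (x 0 i * y 0 i).

Definition hexa (x : vec24) : 'rV[F4]_6 :=
  \row_n \sum_(m | x 0 (mog m n) == 1) mog_label m.

Definition col_parity (x : vec24) (n : 'I_6) : 'F_2 := \sum_m x 0 (mog m n).
Definition row0_parity (x : vec24) : 'F_2 := \sum_n x 0 (mog ord0 n).

Definition golay : {pred vec24} :=
  [pred x | (hexa x <= hexacode_mx)%MS
            && [forall n, col_parity x n == row0_parity x]].

Lemma hexaD (x y : vec24) : hexa (x + y) = hexa x + hexa y.
Proof.
apply/rowP=> n; rewrite !mxE.
rewrite (big_mkcond (fun m => (x + y) 0 (mog m n) == 1)).
rewrite (big_mkcond (fun m => x 0 (mog m n) == 1)).
rewrite (big_mkcond (fun m => y 0 (mog m n) == 1)) -big_split /=.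
apply: eq_bigr => m _; rewrite mxE.
have ll a : a + a = 0 :> F4 by apply/eqP; elim/F4_ind4: a.
by elim/F2_ind: (x _ _); elim/F2_ind: (y _ _); rewrite /= ?addr0 ?add0r ?ll.
Qed.

Lemma golay_zmod_closed : zmod_closed golay.
Proof.
have oppv (y : vec24) : - y = y.
  by apply/rowP=> i; rewrite mxE; elim/F2_ind: (y 0 i); apply/eqP.
split=> [|x y].
  rewrite inE; apply/andP; split.
    suff ->: hexa 0 = 0 by apply: sub0mx.
    by apply/rowP=> n; rewrite !mxE big1 // => m; rewrite mxE.
  apply/forallP=> n.
  by rewrite /col_parity /row0_parity !big1 // => ? _; rewrite mxE.
rewrite oppv !inE => /andP[hx /forallP px] /andP[hy /forallP py].
rewrite hexaD addmx_sub //=; apply/forallP => n.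
have Dcol : col_parity (x + y) n = col_parity x n + col_parity y n.
  by rewrite -big_split; apply: eq_bigr => m _; rewrite mxE.
have Drow : row0_parity (x + y) = row0_parity x + row0_parity y.
  by rewrite -big_split; apply: eq_bigr => m _; rewrite mxE.
by rewrite Dcol Drow (eqP (px n)) (eqP (py n)).
Qed.
HB.instance Definition _ := GRing.isZmodClosed.Build vec24 golay
  golay_zmod_closed.

Record code := Code { codeword :> vec24; codewordP : codeword \in golay }.
HB.instance Definition _ := [isSub for codeword].
HB.instance Definition _ := [Finite of code by <:].
HB.instance Definition _ := [SubChoice_isSubZmodule of code by <:].

Definition cocode : Type := {ideal_quot golay}.
HB.instance Definition _ := GRing.Zmodule.on cocode.
HB.instance Definition _ : isCountable cocode :=
  CanIsCountable (@reprK _ {ideal_quot golay}).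
HB.instance Definition _ : isFinite cocode :=
  CanIsFinite (@reprK _ {ideal_quot golay}).

Definition cls (x : vec24) : cocode := (\pi_{ideal_quot golay} x)%qT.

Lemma card24E (x : vec24) : (card24 x)%:R = \sum_i x 0 i :> 'F_2.
Proof.
rewrite /card24 -sum1_card natr_sum big_mkcond /=; apply: eq_bigr => i _.
by rewrite inE; elim/F2_ind: (x 0 i); apply/eqP.
Qed.

Lemma sum_mog (V : nmodType) (F : 'I_24 -> V) :
  \sum_k F k = \sum_n \sum_m F (mog m n).
Proof.
rewrite pair_bigA /= (reindex (fun p : 'I_6 * 'I_4 => mog p.2 p.1)) //=.
exists (fun k => (mog_col k, mog_row k)) => [[n m] _ | k _] /=.
  by rewrite mog_rowK mog_colK.
apply: val_inj; rewrite /= mogE !inordK ?ltn_mod ?ltn_divLR ?ltn_ord //.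
by rewrite addnC mulnC -divn_eq.
Qed.

(* The trace of x * conj y, conj being the nontrivial automorphism of F4.     *)
Definition trF4 (x y : F4) : 'F_2 := F4re x * F4im y + F4im x * F4re y.

Lemma trF4_suml I (r : seq I) (F : I -> F4) y :
  trF4 (\sum_(i <- r) F i) y = \sum_(i <- r) trF4 (F i) y.
Proof.
apply: (big_morph (fun x => trF4 x y)) => [u v|].
  by rewrite /trF4 /= !mulrDl addrACA.
by rewrite /trF4 !mul0r addr0.
Qed.

Lemma trF4_sumr I (r : seq I) (F : I -> F4) x :
  trF4 x (\sum_(i <- r) F i) = \sum_(i <- r) trF4 x (F i).
Proof.
apply: (big_morph (trF4 x)) => [u v|].
  by rewrite /trF4 /= !mulrDr addrACA.
by rewrite /trF4 !mulr0 addr0.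
Qed.

Lemma hexacode_orthogonal (u v : 'rV[F4]_6) :
  (u <= hexacode_mx)%MS -> (v <= hexacode_mx)%MS ->
  \sum_n trF4 (u 0 n) (v 0 n) = 0.
Proof.
case/submxP=> a ->; case/submxP=> b ->.
transitivity (\sum_i \sum_j \sum_n
    trF4 (a 0 i * hexacode_mx i n) (b 0 j * hexacode_mx j n)).
  rewrite exchange_big; under eq_bigr do rewrite exchange_big.
  rewrite exchange_big /=; apply: eq_bigr => n _.
  rewrite !mxE trF4_sumr; apply: eq_bigr => j _.
  by rewrite trF4_suml.
rewrite big1 // => i _; rewrite big1 // => j _; move: (a 0 i) (b 0 j) => c c'.
rewrite !big_ord_recr big_ord0 /= !mxE /=; apply/eqP.
case: i => [[|[|[|//]]] lti] /=; case: j => [[|[|[|//]]] ltj] /=;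
by elim/F4_ind4: c; elim/F4_ind4: c'.
Qed.

Lemma hexaE (x : vec24) n : hexa x 0 n =
  MkF4 (x 0 (mog 1 n) + x 0 (mog 3 n)) (x 0 (mog 2 n) + x 0 (mog 3 n)).
Proof.
rewrite mxE big_mkcond !big_ord_recl big_ord0 /mog_label /=.
have E (i j : 'I_4) : i = j :> nat -> x 0 (mog i n) = x 0 (mog j n).
  by move/val_inj->.
rewrite !(E _ 1 erefl, E _ 2 erefl, E _ 3 erefl); apply/eqP.
elim/F2_ind: (x 0 (mog ord0 n)); elim/F2_ind: (x 0 (mog 1 n));
elim/F2_ind: (x 0 (mog 2 n)); by elim/F2_ind: (x 0 (mog 3 n)).
Qed.

Lemma golay_self_orthogonal (x y : vec24) : x \in golay -> y \in golay ->
  \sum_i x 0 i * y 0 i = 0.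
Proof.
rewrite !inE => /andP[hx /forallP px] /andP[hy /forallP py].
rewrite sum_mog.
transitivity (\sum_n (trF4 (hexa x 0 n) (hexa y 0 n) +
   (row0_parity x * y 0 (mog ord0 n) + row0_parity y * x 0 (mog ord0 n)
     + row0_parity x * row0_parity y))).
  apply: eq_bigr => n _; rewrite -(eqP (px n)) -(eqP (py n)) !hexaE.
  rewrite /col_parity !big_ord_recl !big_ord0 /trF4 /=.
  have E (z : vec24) (i j : 'I_4) :
      i = j :> nat -> z 0 (mog i n) = z 0 (mog j n).
    by move/val_inj->.
  rewrite !(E _ _ 1 erefl, E _ _ 2 erefl, E _ _ 3 erefl); apply/eqP.
  elim/F2_ind: (x 0 (mog ord0 n)); elim/F2_ind: (x 0 (mog 1 n));
  elim/F2_ind: (x 0 (mog 2 n)); elim/F2_ind: (x 0 (mog 3 n));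
  elim/F2_ind: (y 0 (mog ord0 n)); elim/F2_ind: (y 0 (mog 1 n));
  elim/F2_ind: (y 0 (mog 2 n)); by elim/F2_ind: (y 0 (mog 3 n)).
rewrite big_split /= hexacode_orthogonal // add0r !big_split /= -!mulr_sumr.
rewrite -/(row0_parity x) -/(row0_parity y) sumr_const card_ord.
by apply/eqP; elim/F2_ind: (row0_parity x); elim/F2_ind: (row0_parity y).
Qed.

Definition pairing (d : code) (delta : cocode) : 'F_2 :=
  (card24 (meet24 d (repr delta)))%:R.

(* The pairing does not depend on the representative of the cocode element.   *)
Lemma pairing_cls (d : code) (x : vec24) :
  pairing d (cls x) = (card24 (meet24 d x))%:R.
Proof.
have : repr (cls x) - x \in golay.
  by rewrite Quotient.idealrBE reprK eqxx.
move/(golay_self_orthogonal (codewordP d)) => orth.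
rewrite /pairing !card24E; apply/eqP; rewrite -subr_eq0 -sumrB.
apply/eqP; rewrite -[RHS]orth; apply: eq_bigr => i _.
by rewrite !mxE -mulrBr.
Qed.

Definition grey : {pred code} :=
  [pred d : code | [forall n, forall m1, forall m2,
     (m1 != ord0) && (m2 != ord0) ==> (d 0 (mog m1 n) == d 0 (mog m2 n))]].

Definition coloured : {pred code} :=
  [pred d : code | [forall n, (d 0 (mog ord0 n) == 0) &&
     (#|[set m | d 0 (mog m n) == 1]| \in [:: 0%N; 2%N])]].

Definition grey_dual : {pred cocode} :=
  [pred delta | [forall h : code, (h \in coloured) ==> (pairing h delta == 0)]].

Definition grey_basis_vec (i : 'I_6) : vec24 :=
  \row_k (if mog_col k == i then mog_row k != ord0 else mog_row k == ord0)%:R.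

Lemma grey_basis_vecE i m n : grey_basis_vec i 0 (mog m n) =
  (if n == i then m != ord0 else m == ord0)%:R.
Proof. by rewrite mxE mog_rowK mog_colK. Qed.

Lemma grey_basis_golay i : grey_basis_vec i \in golay.
Proof.
rewrite inE; apply/andP; split.
  suff ->: hexa (grey_basis_vec i) = 0 by apply: sub0mx.
  apply/rowP=> n; rewrite hexaE !grey_basis_vecE mxE.
  by case: eqP => _; apply/eqP.
have odd_col n : col_parity (grey_basis_vec i) n = 1.
  rewrite /col_parity !big_ord_recr big_ord0 /= !grey_basis_vecE.
  by case: eqP => _; apply/eqP.
apply/forallP=> n; rewrite odd_col /row0_parity (bigD1 i) //=.
rewrite grey_basis_vecE eqxx eqxx /= add0r.
rewrite (eq_bigr (fun=> 1)) => [|j /negPf ne_ji]; last first.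
  by rewrite grey_basis_vecE ne_ji eqxx.
by rewrite sumr_const cardC1 card_ord.
Qed.

Definition grey_basis (i : 'I_6) : code := Code (grey_basis_golay i).

Definition grey_dual_basis (i : 'I_6) : cocode := cls (delta_mx 0 (mog ord0 i)).

Definition omega : cocode := \sum_i grey_dual_basis i.

(* When b is a basis of an F_2-space containing v, the set of the indices of  *)
(* the nonzero coefficients of v.                                             *)
Definition basis_support (V : zmodType) (b : 'I_6 -> V) (v : V) : {set 'I_6} :=
  odflt set0 [pick A : {set 'I_6} | \sum_(i in A) b i == v].

Definition grey_wt (e : code) : nat := #|basis_support grey_basis e|.
Definition grey_dual_wt (eps : cocode) : nat :=
  #|basis_support grey_dual_basis eps|.
Definition w2 (w : nat) : 'F_2 := 'C(w, 2)%:R.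

Definition gamma (d : code) : cocode :=
  \sum_(n | (1 < #|[set m : 'I_4 | (m != ord0) && (d 0%R (mog m n) == 1%R)]|)%N)
     grey_dual_basis n.

Lemma golay_full : const_mx 1 \in golay.
Proof.
rewrite inE; apply/andP; split.
  suff ->: hexa (const_mx 1) = 0 by apply: sub0mx.
  by apply/rowP=> n; rewrite hexaE !mxE; apply/eqP.
apply/forallP=> n.
have ->: col_parity (const_mx 1) n = \sum_(m < 4) 1.
  by apply: eq_bigr => m _; rewrite mxE.
have ->: row0_parity (const_mx 1) = \sum_(k < 6) 1.
  by apply: eq_bigr => k _; rewrite mxE.
by rewrite !sumr_const !card_ord.
Qed.

Definition full_code : code := Code golay_full.

(* The maps P, C and A of the Parker loop; loopA2 is the cocode-valued A.     *)
Definition loopP (d : code) : 'F_2 := (card24 d %/ 4)%:R.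
Definition loopC (d e : code) : 'F_2 := (card24 (meet24 d e) %/ 2)%:R.
Definition loopA (d e f : code) : 'F_2 :=
  (card24 (meet24 (meet24 d e) f))%:R.
Definition loopA2 (d e : code) : cocode := cls (meet24 d e).

(* theta' is the cocode-valued form d |-> theta(d) of the cocycle theta.      *)
Record parker_cocycle (theta : code -> code -> 'F_2) (theta' : code -> cocode)
    : Prop := ParkerCocycle {
  pairing_theta : forall d e, pairing e (theta' d) = theta d e;
  theta_diag : forall d, theta d d = loopP d;
  theta_comm : forall d e, theta d e + theta e d = loopC d e;
  theta_addl : forall d e f,
    theta (d + e) f = theta d f + theta e f + loopA d e f;
  theta_addr : forall d e f, theta d (e + f) = theta d e + theta d f;
  theta_full : forall d, theta' (d + full_code) = theta' d;
  theta_grey : forall e, e \in grey ->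
    theta' e = gamma e *~ ((grey_wt e)%:Z - 1) + omega *+ w2 (grey_wt e);
  theta_grey_coloured : forall e h, e \in grey -> h \in coloured ->
    theta e h = 0;
  theta_coloured_grey : forall e h, e \in grey -> h \in coloured ->
    theta h e = pairing e (gamma h)
}.

Definition parker_loop : Type := code * 'F_2.

Definition parker_mul (theta : code -> code -> 'F_2) (d e : parker_loop)
  : parker_loop := (d.1 + e.1, d.2 + e.2 + theta d.1 e.1).

Definition parker_m1 : parker_loop := (0, 1).

(* The finite group gT is Q_x, with generators xP d (d in the Parker loop)    *)
(* and xC delta (delta in the cocode).                                        *)
Record is_Qx (theta : code -> code -> 'F_2) (gT : finGroupType)
    (xP : parker_loop -> gT) (xC : cocode -> gT) : Prop := IsQx {
  Qx_order : #|[set: gT]| = (2 ^ 25)%N;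
  Qx_gen : <<(xP @: setT) :|: (xC @: setT)>>%g = [set: gT];
  Qx_central : forall g, commute (xP parker_m1) g;
  Qx_sqrP : forall d, (xP d ^+ 2 = xP parker_m1 ^+ loopP d.1)%g;
  Qx_sqrC : forall delta, (xC delta ^+ 2 = 1)%g;
  Qx_mulP : forall d e,
    (xP d * xP e = xP (parker_mul theta d e) * xC (loopA2 d.1 e.1))%g;
  Qx_mulC : forall delta eps, (xC delta * xC eps = xC (delta + eps)%R)%g;
  Qx_commPC : forall d delta,
    ([~ xP d, xC delta] = xP parker_m1 ^+ pairing d.1 delta)%g
}.

Definition tilde_x (theta' : code -> cocode) (gT : finGroupType)
    (xP : parker_loop -> gT) (xC : cocode -> gT) (d : code) : gT :=
  (xP (d, 0%R) * xC (theta' d))%g.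

(* rho stands for a representation of Q_x, extended to the group ring.        *)
Definition xi_gamma (R : fieldType) (n : nat) (gT : finGroupType)
    (xC : cocode -> gT) (rho : gT -> 'M[R]_n) : 'M[R]_n :=
  8^-1 *: \sum_(eps in grey_dual) (-1) ^+ w2 (grey_dual_wt eps) *: rho (xC eps).

Definition xi_g (R : fieldType) (n : nat) (theta' : code -> cocode)
    (gT : finGroupType) (xP : parker_loop -> gT) (xC : cocode -> gT)
    (rho : gT -> 'M[R]_n) : 'M[R]_n :=
  8^-1 *: \sum_(e in grey)
            (-1) ^+ w2 (grey_wt e) *: rho (tilde_x theta' xP xC e).

Definition xi (R : fieldType) (n : nat) (theta' : code -> cocode)
    (gT : finGroupType) (xP : parker_loop -> gT) (xC : cocode -> gT)
    (rho : gT -> 'M[R]_n) : 'M[R]_n :=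
  xi_gamma xC rho *m xi_g theta' xP xC rho.

(* Groups act from the right, that is, by right multiplication on row         *)
(* vectors; Euclidean structures are given by their Gram matrices.            *)
Definition euclidean (R : realType) (n : nat) (B : 'M[R]_n) : Prop :=
  B^T = B /\ forall v : 'rV[R]_n, v != 0 -> 0 < (v *m B *m v^T) 0 0.

Definition orthogonal_for (R : realType) (n : nat) (B u : 'M[R]_n) : Prop :=
  u *m B *m u^T = B.

Definition gram24 (R : realType) : 'M[R]_24 := (8^-1)%:M.

Definition leech (R : realType) (u : 'rV[R]_24) : Prop :=
  exists2 z : 'rV[int]_24, u = map_mx intr z &
  exists (m : bool) (d : code),
    (forall i, (z 0%R i = m%:Z + 2 * (d 0%R i : nat)%:Z %[mod 4])%Z) /\
    ((\sum_i z 0 i)%R = 4 * m%:Z %[mod 8])%Z.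

(* Congruence modulo 2 Leech.                                                 *)
Definition leech_eq2 (R : realType) (u v : 'rV[R]_24) : Prop :=
  exists2 w, leech w & u - v = w *+ 2.

(* iota lifts an isomorphism Q_x / {1, x_{-1}} -> Leech / 2 Leech: iota q is  *)
(* a representative of the image of the class of q.                           *)
Record leech_iso (R : realType) (gT : finGroupType) (xP : parker_loop -> gT)
    (xC : cocode -> gT) (iota : gT -> 'rV[R]_24) : Prop := LeechIso {
  leech_iso_in : forall q, leech (iota q);
  leech_isoM : forall q r, leech_eq2 (iota (q * r)%g) (iota q + iota r);
  leech_iso_ker : forall q,
    leech_eq2 (iota q) 0 <-> q \in [set 1%g; xP parker_m1];
  leech_iso_surj : forall u, leech u -> exists q, leech_eq2 (iota q) u;
  leech_iso_point : forall i : 'I_24,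
    leech_eq2 (iota (xC (cls (delta_mx 0 i))))
              (\row_j if j == i then - 3 else 1);
  leech_iso_code0 : forall d : parker_loop, (card24 d.1 = 0 %[mod 8])%N ->
    leech_eq2 (iota (xP d)) (\row_j if d.1 0 j == 1 then 2 else 0);
  leech_iso_code4 : forall d : parker_loop, (card24 d.1 = 4 %[mod 8])%N ->
    leech_eq2 (iota (xP d)) (\row_j if d.1 0 j == 1 then 0 else 2)
}.

Definition in_G24 (R : realType) (v : 'M[R]_24) : Prop :=
  orthogonal_for (gram24 R) v /\ forall u, leech u <-> leech (u *m v).

Definition normalizes (R : realType) (n : nat) (gT : finGroupType)
    (rho : gT -> 'M[R]_n) (u : 'M[R]_n) : Prop :=
  forall X, (exists q, X = rho q) <-> (exists q, invmx u *m X *m u = rho q).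

(* Conjugation by u on Q_x / {1, x_{-1}} corresponds, under iota, to the      *)
(* action of v on Leech / 2 Leech. As Co_1 acts faithfully there, for u in    *)
(* G(4096_x) and v in Co_0 this says that u and v have the same image.        *)
Definition same_action (R : realType) (n : nat) (gT : finGroupType)
    (rho : gT -> 'M[R]_n) (iota : gT -> 'rV[R]_24)
    (u : 'M[R]_n) (v : 'M[R]_24) : Prop :=
  forall q r, invmx u *m rho q *m u = rho r ->
    leech_eq2 (iota r) (iota q *m v).

Definition in_holomorph (R : realType) (n : nat) (gT : finGroupType)
    (B : 'M[R]_n) (rho : gT -> 'M[R]_n) (u : 'M[R]_n) : Prop :=
  orthogonal_for B u /\ normalizes rho u.

Definition in_G4096 (R : realType) (n : nat) (gT : finGroupType)
    (B : 'M[R]_n) (rho : gT -> 'M[R]_n) (iota : gT -> 'rV[R]_24)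
    (u : 'M[R]_n) : Prop :=
  in_holomorph B rho u /\ exists2 v, in_G24 v & same_action rho iota u v.

(* *t is the Kronecker product, the matrix of the tensor product of maps.     *)
Definition in_Gx0 (R : realType) (n : nat) (gT : finGroupType)
    (B : 'M[R]_n) (rho : gT -> 'M[R]_n) (iota : gT -> 'rV[R]_24)
    (T : 'M[R]_(n * 24)) : Prop :=
  exists u v, [/\ in_G4096 B rho iota u, in_G24 v, same_action rho iota u v
                & T = u *t v].

Definition xi_4a (R : realType) : 'M[R]_4 :=
  2^-1 *: \matrix_(i, j) (nth [::]
    [:: [:: 1; -1; -1; -1];
        [:: -1; 1; -1; -1];
        [:: -1; -1; 1; -1];
        [:: -1; -1; -1; 1]] i)`_j.

Definition xi_4b (R : realType) : 'M[R]_4 :=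
  diag_mx (\row_j [:: -1; 1; 1; 1]`_j).

Definition mog_block (R : realType) (M : 'M[R]_4) : 'M[R]_24 :=
  \matrix_(i, j)
    if mog_col i == mog_col j then M (mog_row i) (mog_row j) else 0.

Definition xi_24 (R : realType) : 'M[R]_24 :=
  mog_block (xi_4a R) *m mog_block (xi_4b R).

(* Main.v *)
Require Import Defs.
From mathcomp Require Import all_boot all_order all_algebra all_fingroup.
From mathcomp Require Import generic_quotient ring_quotient.
From mathcomp Require Import mxrepresentation reals mxtens.
From mathcomp Require Import zify ring lra.

(** The elements [tilde_x d], d in the Golay code, multiply like the vectors d
    ([txD]): the cocycle theta enters both in the product of the Parker loop
    and in the factor [x_theta(d)], and the two contributions cancel. Hence,
    up to the centre, Q_x is the product of the code C and the cocode C^*, an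
    element being [tilde_x d * x_delta] ([heisP]), and a commutator is given
    by the pairing of C and C^*.

    The element xi_gamma is a normalized sum, over the elementary abelian
    group of the x_epsilon with epsilon grey, with signs given by the
    quadratic form w_2 on F_2^6. The polar form of w_2 is nondegenerate
    ([q6D], [flipK]), so such a Gauss sum is an involution ([gaussK]), and
    moving an element X across it multiplies X by that x_c for which the polar
    form of w_2 with c is the commutator character of X ([gauss_conj]). The
    same holds for xi_g and the [tilde_x e] with e grey. Both involutions are
    orthogonal and normalize Q_x. In terms of pairs (d, delta), conjugation by
    xi = xi_gamma * xi_g first adds to delta a grey cocode word that depends
    on row 0 of d, and then adds to d a grey code word that depends on the
    products of the new delta with g_0, ..., g_5 ([xi_conj]).

    The matrix xi_24 is orthogonal and of order 3. It preserves the Leech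
    lattice because, on vectors written as m + 2 c, it acts on the integral
    data (m, c) by a formula from which the congruences can be read off
    ([leech_xi24]).

    Both actions on Leech modulo 2 Leech are linear, so they need only be
    compared on generators of Q_x: the points of the array, the grey words g_i
    and the coloured words over hexacode words of weight 4
    ([compatible_point], [compatible_grey_basis], [compatible_coloured4]). On
    these, theta is given by the formulas for the grey and coloured parts, and
    both images are explicit vectors whose difference is twice a Leech vector.
    That these elements generate follows from the decomposition of the code
    into its grey and coloured parts ([golay_decomp]). *)

Set Implicit Arguments.
Unset Strict Implicit.
Unset Printing Implicit Defensive.

Import Order.TTheory GRing.Theory Num.Theory.
Local Open Scope ring_scope.

(** * Arithmetic modulo 2 and the coordinates of the array *)

Lemma addF2 (a : 'F_2) : a + a = 0.
Proof. by elim/F2_ind: a; apply/eqP. Qed.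

Lemma oppF2 (a : 'F_2) : - a = a.
Proof. by elim/F2_ind: a; apply/eqP. Qed.

Lemma addvecxx n (v : 'rV['F_2]_n) : v + v = 0.
Proof. by apply/rowP=> i; rewrite !mxE addF2. Qed.

Lemma I3_ind (P : 'I_3 -> Prop) : P 0 -> P 1 -> P 2 -> forall i, P i.
Proof.
move=> P0 P1 P2 [[|[|[|//]]] lt_i3];
  [move: P0 | move: P1 | move: P2]; congr P; exact: val_inj.
Qed.

Lemma I4_ind (P : 'I_4 -> Prop) :
  P ord0 -> P 1 -> P 2 -> P 3 -> forall m, P m.
Proof.
move=> P0 P1 P2 P3 [[|[|[|[|//]]]] lt_m4];
  [move: P0 | move: P1 | move: P2 | move: P3]; congr P; exact: val_inj.
Qed.

Lemma sum_I4 (V : nmodType) (F : 'I_4 -> V) :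
  \sum_m F m = F ord0 + (F 1 + F 2 + F 3).
Proof.
rewrite big_ord_recl !big_ord_recr big_ord0 /= add0r.
by do 2![congr (_ + _)]; try congr (_ + _); congr F; apply: val_inj.
Qed.

Lemma sum_I6 (V : nmodType) (F : 'I_6 -> V) :
  \sum_n F n = F 0 + (F 1 + (F 2 + (F 3 + (F 4 + F 5)))).
Proof.
rewrite !big_ord_recl big_ord0 addr0.
by do 5?[congr (_ + _)]; congr F; apply: val_inj.
Qed.

Lemma mogK k : mog (mog_row k) (mog_col k) = k.
Proof.
apply: val_inj; rewrite /= mogE !inordK ?ltn_mod ?ltn_divLR ?ltn_ord //.
by rewrite addnC mulnC -divn_eq.
Qed.

Lemma mog_rowP (T : Type) (x y : 'rV[T]_24) :
  (forall m n, x 0 (mog m n) = y 0 (mog m n)) -> x = y.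
Proof. by move=> xy; apply/rowP=> k; rewrite -(mogK k). Qed.

Lemma mog_eq m n m' n' : (mog m n == mog m' n') = (m == m') && (n == n').
Proof.
apply/eqP/andP=> [Em | [/eqP-> /eqP->] //].
by split; apply/eqP; [rewrite -(mog_rowK m n) | rewrite -(mog_colK m n)];
   rewrite Em ?mog_rowK ?mog_colK.
Qed.

Lemma sum_mog4 (V : nmodType) (F : 'I_24 -> V) : \sum_k F k =
  \sum_n (F (mog ord0 n) + (F (mog 1 n) + F (mog 2 n) + F (mog 3 n))).
Proof. by rewrite sum_mog; apply: eq_bigr => n _; rewrite sum_I4. Qed.

(** * The quadratic form w_2 on the words of length 6 *)

Definition supp (a : 'rV['F_2]_6) : {set 'I_6} := [set i | a 0 i == 1].

Definition indic (S : {set 'I_6}) : 'rV['F_2]_6 := \row_i (i \in S)%:R.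

Lemma suppK : cancel supp indic.
Proof.
by move=> a; apply/rowP=> i; rewrite mxE inE; elim/F2_ind: (a 0 i); apply/eqP.
Qed.

Lemma indicK : cancel indic supp.
Proof. by move=> S; apply/setP=> i; rewrite inE mxE; case: (i \in S). Qed.

(** The three maps below describe the polar form of [w_2]: it sends (a, b) to
    [dot a (flip b)]. *)
Definition tot (a : 'rV['F_2]_6) : 'F_2 := \sum_i a 0 i.
Definition flip (a : 'rV['F_2]_6) : 'rV['F_2]_6 := a + const_mx (tot a).
Definition dot (a b : 'rV['F_2]_6) : 'F_2 := \sum_i a 0 i * b 0 i.
Definition q6 (a : 'rV['F_2]_6) : 'F_2 := w2 #|supp a|.

Lemma totD a b : tot (a + b) = tot a + tot b.
Proof. by rewrite -big_split; apply: eq_bigr => i _; rewrite mxE. Qed.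

Lemma tot_const c : tot (const_mx c) = 0.
Proof.
rewrite /tot (eq_bigr (fun=> c)) => [|i _]; last by rewrite mxE.
by rewrite sumr_const card_ord; elim/F2_ind: c; apply/eqP.
Qed.

Lemma flipD a b : flip (a + b) = flip a + flip b.
Proof. by rewrite /flip totD raddfD addrACA. Qed.

Lemma flip0 : flip 0 = 0.
Proof. by rewrite -{1}(addvecxx 0) flipD addvecxx. Qed.

(** This is where the length 6 enters: a constant word of even length has sum
    0. *)
Lemma flipK : involutive flip.
Proof.
move=> a; rewrite /flip totD tot_const addr0 -addrA.
by rewrite addvecxx addr0.
Qed.

Lemma dotC a b : dot a b = dot b a.
Proof. by apply: eq_bigr => i _; rewrite mulrC. Qed.

Lemma dotDl a b c : dot (a + b) c = dot a c + dot b c.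
Proof. by rewrite -big_split; apply: eq_bigr => i _; rewrite mxE mulrDl. Qed.

Lemma dot0r a : dot a 0 = 0.
Proof. by rewrite /dot big1 // => i _; rewrite [X in _ * X]mxE mulr0. Qed.

Lemma dot_indic1 i b : dot (indic [set i]) b = b 0 i.
Proof.
rewrite /dot (bigD1 i) //= mxE in_set1 eqxx mul1r big1 ?addr0 // => j ji.
by rewrite mxE in_set1 (negPf ji) mul0r.
Qed.

Lemma dot_flip a b : dot a (flip b) = dot a b + tot a * tot b.
Proof.
rewrite /dot /tot mulr_suml -big_split; apply: eq_bigr => i _.
by rewrite !mxE mulrDr.
Qed.

Lemma dot_flipC a b : dot a (flip b) = dot (flip a) b.
Proof. by rewrite [RHS]dotC !dot_flip dotC mulrC. Qed.

Lemma tot_card a : tot a = #|supp a|%:R.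
Proof.
rewrite -sum1_card natr_sum [RHS]big_mkcond; apply: eq_bigr => i _.
by rewrite inE; elim/F2_ind: (a 0 i); apply/eqP.
Qed.

Lemma dot_card a b : dot a b = #|supp a :&: supp b|%:R.
Proof.
rewrite -sum1_card natr_sum [RHS]big_mkcond; apply: eq_bigr => i _.
by rewrite !inE; elim/F2_ind: (a 0 i); elim/F2_ind: (b 0 i); apply/eqP.
Qed.

Lemma w2D m n : w2 (m + n) = w2 m + w2 n + (m * n)%:R.
Proof.
rewrite /w2 -!natrD; congr _%:R; elim: m => [|m IHm].
  by rewrite bin0n mul0n addn0.
by rewrite addSn !binS !bin1 IHm; lia.
Qed.

Lemma suppD a b :
  supp (a + b) = (supp a :\: supp b) :|: (supp b :\: supp a).
Proof.
apply/setP=> i; rewrite !inE mxE.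
by elim/F2_ind: (a 0 i); elim/F2_ind: (b 0 i).
Qed.

(** The supports A and B of the words are cut into A - B, B - A and their
    intersection, of sizes x, y and k. All the sizes involved are sums of
    these, and [w2] of a sum is expanded by [w2D]. *)
Lemma q6D a b : q6 (a + b) = q6 a + q6 b + dot a (flip b).
Proof.
rewrite dot_flip !tot_card dot_card /q6 suppD cardsU.
have -> : (supp a :\: supp b) :&: (supp b :\: supp a) = set0.
  by apply/setP=> i; rewrite !inE; case: (a 0 i == 1); case: (b 0 i == 1).
rewrite cards0 subn0.
have := cardsID (supp b) (supp a); have := cardsID (supp a) (supp b).
rewrite [supp b :&: _]setIC => <- <-.
move: #|_ :&: _| #|_ :\: _| #|_ :\: _| => k y x.
rewrite !w2D !natrM !natrD.
move: (w2 x) (w2 y) (w2 k) (x%:R : 'F_2) (y%:R : 'F_2) (k%:R : 'F_2).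
move=> wx wy wk {}x {}y {}k; apply/eqP.
have F2_sq : k * k = k by elim/F2_ind: k; apply/eqP.
rewrite -subr_eq0 oppF2; apply/eqP.
(* Every term of the sum of the two sides occurs twice, k and k * k being
   equal. *)
transitivity ((wx + wx) + (wy + wy) + (wk + wk) + (x * y + x * y)
  + (k * x + k * x) + (k * y + k * y) + (k * k + k)); first by ring.
by rewrite !addF2 F2_sq !addF2.
Qed.

Lemma q60 : q6 0 = 0.
Proof.
rewrite /q6; have -> : supp 0 = set0 by apply/setP=> i; rewrite !inE mxE.
by rewrite cards0.
Qed.

(** F_2-linear combinations in an abelian group that is only known to have
    exponent 2: the coefficients act as the natural numbers 0 and 1. *)
Definition F2comb (V : zmodType) (b : 'I_6 -> V) (a : 'rV['F_2]_6) : V :=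
  \sum_i b i *+ a 0 i.

Lemma F2comb_supp (V : zmodType) (b : 'I_6 -> V) a :
  F2comb b a = \sum_(i in supp a) b i.
Proof.
rewrite /F2comb [RHS]big_mkcond; apply: eq_bigr => i _; rewrite inE.
by elim/F2_ind: (a 0 i).
Qed.

Lemma F2comb0 (V : zmodType) (b : 'I_6 -> V) : F2comb b 0 = 0.
Proof. by rewrite /F2comb big1 // => i _; rewrite mxE mulr0n. Qed.

Lemma F2combD (V : zmodType) (b : 'I_6 -> V) a a' :
  (forall v : V, v + v = 0) -> F2comb b (a + a') = F2comb b a + F2comb b a'.
Proof.
move=> char2; rewrite -big_split; apply: eq_bigr => i _; rewrite mxE.
elim/F2_ind: (a 0 i); elim/F2_ind: (a' 0 i) => /=;
by rewrite ?mulr0n ?addr0 ?add0r ?char2.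
Qed.

(** Independence of [b] makes the choice in [basis_support] irrelevant. *)
Lemma basis_support_F2comb (V : zmodType) (b : 'I_6 -> V) a :
  injective (F2comb b) -> basis_support b (F2comb b a) = supp a.
Proof.
move=> inj_b; rewrite /basis_support; case: pickP => [A /eqP Eb | /(_ (supp a))].
  rewrite -[A]indicK; congr supp; apply: inj_b.
  by rewrite F2comb_supp indicK.
by rewrite F2comb_supp eqxx.
Qed.

(** * Gauss sums of w_2 *)

Lemma signF2D (R : pzRingType) (a b : 'F_2) :
  (-1) ^+ (a + b)%R = (-1) ^+ a * (-1) ^+ b :> R.
Proof.
elim/F2_ind: a; first by rewrite add0r expr0 mul1r.
elim/F2_ind: b; first by rewrite addr0 expr0 mulr1.
by rewrite expr1 mulrNN mulr1.
Qed.

(** For c nonzero, translation by a unit vector on which c does not vanish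
    changes the sign of every term. *)
Lemma sum_sign_dot (R : realFieldType) c :
  \sum_a (-1) ^+ dot a c = (if c == 0 then 64 else 0) :> R.
Proof.
case: eqP => [-> | /eqP nz_c].
  under eq_bigr do rewrite dot0r expr0.
  by rewrite sumr_const card_mx card_Fp.
have [i ci] : exists i, c 0 i != 0.
  apply/existsP; apply: contraR nz_c => /existsPn c0; apply/eqP/rowP=> i.
  by rewrite mxE; apply/eqP; rewrite -[_ == _]negbK c0.
have /eqP : \sum_a (-1) ^+ dot a c = - \sum_a (-1) ^+ dot a c :> R.
  rewrite {1}(reindex_inj (addIr (indic [set i]))) -sumrN /=.
  apply: eq_bigr => a _; rewrite dotDl signF2D dot_indic1.
  by move: ci; elim/F2_ind: (c 0 i) => //= _; rewrite expr1 mulrN1.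
by rewrite -subr_eq0 opprK -mulr2n mulrn_eq0 /= => /eqP.
Qed.

(** The group F_2^6 is represented by commuting involutions [s a]. *)
Section Gauss.

Variables (R : realFieldType) (n : nat) (s : 'rV['F_2]_6 -> 'M[R]_n).
Hypotheses (s0 : s 0 = 1%:M) (sD : forall a b, s (a + b) = s a *m s b).

Definition gauss : 'M[R]_n := 8^-1 *: \sum_a (-1) ^+ q6 a *: s a.

(** Moving X to the left of the sum twists the term of index a by the
    character [dot a l], which is the polar form of [q6] with [c = flip l].
    Completing the square, that is, shifting the index by c, turns the twisted
    sum into a multiple of the original one. *)
Lemma gauss_conj (X : 'M[R]_n) l :
    (forall a, X *m s a = (-1) ^+ dot a l *: (s a *m X)) ->
  gauss *m X = (-1) ^+ q6 (flip l) *: (X *m s (flip l) *m gauss).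
Proof.
move=> commX; set c := flip l.
have commXs b : s b *m X = (-1) ^+ dot b l *: (X *m s b).
  by rewrite commX scalerA -signF2D addF2 expr0 scale1r.
(* q6 (c + c) = 0 says that c is isotropic for the polar form. *)
have q_cc : dot c l = 0.
  by have := q6D c c; rewrite addvecxx q60 addF2 add0r flipK => <-.
rewrite /gauss -scalemxAr -!scalemxAl scalerA mulrC -scalerA; congr (_ *: _).
rewrite mulmx_suml mulmx_sumr scaler_sumr (reindex_inj (addrI c)) /=.
apply: eq_bigr => b _; rewrite -scalemxAl -scalemxAr !scalerA -signF2D.
rewrite commXs sD scalerA mulmxA -signF2D; congr ((-1) ^+ nat_of_ord _ *: _).
rewrite q6D dot_flipC flipK dotDl q_cc add0r [dot l b]dotC.
by rewrite -addrA addF2 addr0.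
Qed.

(** The coefficient of [s c] in the square is a character sum in
    [flip c], which is zero unless c is, and then compensates 1/64. *)
Lemma gaussK : gauss *m gauss = 1%:M.
Proof.
rewrite /gauss -scalemxAl -scalemxAr scalerA mulmx_suml.
under eq_bigr do rewrite mulmx_sumr.
transitivity ((8^-1 * 8^-1) *:
    \sum_c \sum_a (-1) ^+ dot a (flip c) *: ((-1) ^+ q6 c *: s c) : 'M[R]_n).
  congr (_ *: _); rewrite [RHS]exchange_big; apply: eq_bigr => a _.
  rewrite (reindex_inj (addrI a)) /=; apply: eq_bigr => c _.
  rewrite -scalemxAl -scalemxAr -sD addrA addvecxx add0r !scalerA -!signF2D q6D.
  congr ((-1) ^+ nat_of_ord _ *: _).
  by rewrite addrA addrA addF2 add0r addrC.
under eq_bigr do rewrite -scaler_suml sum_sign_dot.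
rewrite (bigD1 0) //= big1 => [|c /negPf nz_c]; last first.
  by rewrite (can2_eq flipK flipK) flip0 nz_c scale0r.
rewrite flip0 eqxx q60 expr0 scale1r addr0 scalerA s0.
by rewrite -[RHS]scale1r; congr (_ *: _); field.
Qed.

End Gauss.

(** The [s a] are both involutions and isometries, so they are self-adjoint;
    then so is their linear combination [gauss s], which is an involution. *)
Lemma gauss_orthogonal (R : realType) (n : nat) (s : 'rV['F_2]_6 -> 'M[R]_n)
    (s0 : s 0 = 1%:M) (sD : forall a b, s (a + b) = s a *m s b) (B : 'M[R]_n) :
  (forall a, orthogonal_for B (s a)) -> orthogonal_for B (gauss s).
Proof.
move=> orth_s; rewrite /orthogonal_for.
suff -> : gauss s *m B = B *m (gauss s)^T.
  by rewrite -mulmxA -trmx_mul gaussK // trmx1 mulmx1.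
have -> : (gauss s)^T = 8^-1 *: \sum_a (-1) ^+ q6 a *: (s a)^T.
  rewrite [LHS]linearZ; congr (_ *: _); rewrite [LHS]linear_sum.
  by apply: eq_bigr => a _; rewrite [LHS]linearZ.
rewrite /gauss -scalemxAl -scalemxAr mulmx_suml mulmx_sumr; congr (_ *: _).
apply: eq_bigr => a _; rewrite -scalemxAl -scalemxAr; congr (_ *: _).
by rewrite -[in RHS](orth_s a) -!mulmxA -trmx_mul -sD addvecxx s0 trmx1 mulmx1.
Qed.

(** * Duality between the Golay code and its cocode *)

Lemma addcodexx (d : code) : d + d = 0.
Proof. by apply: val_inj; apply: addvecxx. Qed.

Lemma codewordD (d e : code) : codeword (d + e) = codeword d + codeword e.
Proof. by []. Qed.

Lemma clsD (x y : vec24) : cls (x + y) = cls x + cls y.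
Proof. exact: (raddfD (\pi_{ideal_quot golay})%qT). Qed.

Lemma cls0 : cls 0 = 0.
Proof. exact: (raddf0 (\pi_{ideal_quot golay})%qT). Qed.

Lemma cls_golay (x : vec24) : x \in golay -> cls x = 0.
Proof.
by move=> Cx; rewrite -cls0; apply/eqP; rewrite -Quotient.idealrBE subr0.
Qed.

Lemma clsP (delta : cocode) : exists x, delta = cls x.
Proof. by exists (repr delta); rewrite /cls reprK. Qed.

Lemma addcocodexx (delta : cocode) : delta + delta = 0.
Proof. by have [x ->] := clsP delta; rewrite -clsD addvecxx cls0. Qed.

Lemma pairingE (d : code) x : pairing d (cls x) = \sum_i d 0 i * x 0 i.
Proof. by rewrite pairing_cls card24E; apply: eq_bigr => i _; rewrite mxE. Qed.

Lemma pairingDr d delta eps :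
  pairing d (delta + eps) = pairing d delta + pairing d eps.
Proof.
have [[x ->] [y ->]] := (clsP delta, clsP eps); rewrite -clsD !pairingE.
by rewrite -big_split; apply: eq_bigr => i _; rewrite mxE mulrDr.
Qed.

Lemma pairingDl d e delta :
  pairing (d + e) delta = pairing d delta + pairing e delta.
Proof.
have [x ->] := clsP delta; rewrite !pairingE.
by rewrite -big_split; apply: eq_bigr => i _; rewrite codewordD mxE mulrDl.
Qed.

Lemma pairing0r d : pairing d 0 = 0.
Proof. by rewrite -(addF2 (pairing d 0)) -pairingDr addr0. Qed.

Lemma pairing0l delta : pairing 0 delta = 0.
Proof. by rewrite -(addF2 (pairing 0 delta)) -pairingDl addr0. Qed.

Lemma pairing_point (d : code) k : pairing d (cls (delta_mx 0 k)) = d 0 k.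
Proof.
rewrite pairingE (bigD1 k) //= mxE !eqxx mulr1 big1 ?addr0 // => i /negPf ik.
by rewrite mxE eqxx ik mulr0.
Qed.

Lemma pairing_sumr (I : finType) (P : pred I) d (F : I -> cocode) :
  pairing d (\sum_(i | P i) F i) = \sum_(i | P i) pairing d (F i).
Proof. exact: (big_morph (pairing d) (pairingDr d) (pairing0r d)). Qed.

Lemma pairing_suml (I : finType) (P : pred I) (F : I -> code) delta :
  pairing (\sum_(i | P i) F i) delta = \sum_(i | P i) pairing (F i) delta.
Proof.
apply: (big_morph (pairing^~ delta)) => [d e|]; first exact: pairingDl.
exact: pairing0l.
Qed.

Lemma F4_addxx (x : F4) : x + x = 0.
Proof. by apply/eqP; elim/F4_ind4: x. Qed.

Lemma trF4Dl x y z : trF4 (x + y) z = trF4 x z + trF4 y z.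
Proof. by rewrite /trF4 /= !mulrDl addrACA. Qed.

Definition hexacode_row (i : 'I_3) : 'rV[F4]_6 := row i hexacode_mx.

Lemma hexacode_rowP i (c : F4) : (c *: hexacode_row i <= hexacode_mx)%MS.
Proof. by rewrite scalemx_sub // row_sub. Qed.

(** The parts in the last three columns of the three generators of the
    hexacode form an invertible matrix. *)
Lemma hexacode_dual3 (a b c : F4) :
    (forall e, trF4 a e + (trF4 b (e * alphabar) + trF4 c (e * alpha)) = 0) ->
    (forall e, trF4 a e + (trF4 b (e * alpha) + trF4 c (e * alphabar)) = 0) ->
    (forall e, trF4 a e + (trF4 b e + trF4 c e) = 0) ->
  [/\ a = 0, b = 0 & c = 0].
Proof.
move=> E0 E1 E2.
suff /and3P[/eqP-> /eqP-> /eqP->] : [&& a == 0, b == 0 & c == 0] by [].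
move: (E0 1) (E0 alpha) (E1 1) (E1 alpha) (E2 1) (E2 alpha) => {E0 E1 E2}.
do 6!move/eqP; move: a b c; do 3!elim/F4_ind4; by [].
Qed.

(** The generators of the hexacode are in systematic form. Subtracting the
    hexacode word u that agrees with w in columns 0, 1 and 2 leaves a word
    supported on columns 3, 4 and 5, which is still orthogonal to the
    hexacode. *)
Lemma hexacode_dual (w : 'rV[F4]_6) :
    (forall v : 'rV[F4]_6, (v <= hexacode_mx)%MS ->
       \sum_n trF4 (w 0 n) (v 0 n) = 0) ->
  (w <= hexacode_mx)%MS.
Proof.
move=> orth.
pose u := w 0 0 *: hexacode_row 0 + w 0 1 *: hexacode_row 1
          + w 0 2 *: hexacode_row 2.
have Cu : (u <= hexacode_mx)%MS by rewrite !addmx_sub ?hexacode_rowP.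
pose y := w + u.
have orth_y (v : 'rV[F4]_6) :
    (v <= hexacode_mx)%MS -> \sum_n trF4 (y 0 n) (v 0 n) = 0.
  move=> Cv; transitivity (\sum_n trF4 (w 0 n) (v 0 n)
                            + \sum_n trF4 (u 0 n) (v 0 n)).
    by rewrite -big_split; apply: eq_bigr => n _; rewrite mxE trF4Dl.
  by rewrite orth // hexacode_orthogonal // addr0.
have [y0 y1 y2] : [/\ y 0 0 = 0, y 0 1 = 0 & y 0 2 = 0].
  by split; rewrite !mxE /= !(mulr1, mulr0, addr0, add0r) F4_addxx.
have wu : y = 0 -> (w <= hexacode_mx)%MS.
  suff -> : w = y + u by move->; rewrite add0r.
  by apply/rowP=> n; rewrite !mxE -addrA F4_addxx addr0.
move: (y) y0 y1 y2 wu orth_y => {}y y0 y1 y2 wu orth_y.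
have tr0 z : trF4 0 z = 0 by rewrite /trF4 !mul0r addr0.
have tr_y i e := orth_y _ (hexacode_rowP i e).
have [y3 y4 y5] : [/\ y 0 3 = 0, y 0 4 = 0 & y 0 5 = 0].
  apply: hexacode_dual3 => e; [move: (tr_y 0 e) | move: (tr_y 1 e)
    | move: (tr_y 2 e)]; rewrite sum_I6 y0 y1 y2 !tr0 !add0r;
  by rewrite !mxE /= ?mulr1.
apply: wu; apply/rowP=> n; rewrite [RHS]mxE.
have Dn (k : 'I_6) : n = k :> nat -> y 0 k = 0 -> y 0 n = 0.
  by move/val_inj->.
case: n Dn => [[|[|[|[|[|[|//]]]]]] lt_n6] Dn;
by [apply: Dn y0 | apply: Dn y1 | apply: Dn y2 | apply: Dn y3
   | apply: Dn y4 | apply: Dn y5].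
Qed.

Lemma golayP (x : vec24) :
  reflect ((hexa x <= hexacode_mx)%MS /\
           forall n, col_parity x n = row0_parity x) (x \in golay).
Proof.
rewrite inE; apply: (iffP andP) => -[Hx par_x]; split=> //.
  by move=> n; apply/eqP; apply: (forallP par_x).
by apply/forallP=> n; rewrite par_x.
Qed.

(** The coloured word over v: each column has its zero or two ones in the rows
    1, 2, 3, at the unique place where the labels add up to the given
    element of F_4. *)
Definition hexa_lift (v : 'rV[F4]_6) : vec24 :=
  \row_k (let c := v 0 (mog_col k) in
          [:: 0; F4im c; F4re c; F4re c + F4im c]`_(mog_row k)).

Lemma hexa_liftE v m n : hexa_lift v 0 (mog m n) =
  [:: 0; F4im (v 0 n); F4re (v 0 n); F4re (v 0 n) + F4im (v 0 n)]`_m.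
Proof. by rewrite mxE mog_rowK mog_colK. Qed.

Lemma hexa_liftK v : hexa (hexa_lift v) = v.
Proof.
apply/rowP=> n; rewrite hexaE !hexa_liftE /=.
case: (v 0 n) => a b /=; congr MkF4; last by rewrite addrA addF2 add0r.
by rewrite addrCA addF2 addr0.
Qed.

Lemma hexa_liftD u v : hexa_lift (u + v) = hexa_lift u + hexa_lift v.
Proof.
apply: mog_rowP => m n; rewrite [RHS]mxE !hexa_liftE mxE.
by elim/I4_ind: m; rewrite /= ?addr0 // addrACA.
Qed.

Lemma hexa_lift0 : hexa_lift 0 = 0.
Proof.
apply: mog_rowP => m n; rewrite hexa_liftE !mxE.
by apply/eqP; elim/I4_ind: m.
Qed.

Lemma row0_hexa_lift v : row0_parity (hexa_lift v) = 0.
Proof. by rewrite /row0_parity big1 // => n _; rewrite hexa_liftE. Qed.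

Lemma hexa_lift_golay v : (v <= hexacode_mx)%MS -> hexa_lift v \in golay.
Proof.
move=> Hv; apply/golayP; split=> [|n]; first by rewrite hexa_liftK.
rewrite row0_hexa_lift /col_parity sum_I4 !hexa_liftE /=.
by rewrite add0r [F4im _ + _]addrC addF2.
Qed.

Definition coloured_word (v : 'rV[F4]_6) (Hv : (v <= hexacode_mx)%MS) : code :=
  Code (hexa_lift_golay Hv).

Lemma coloured_wordP v (Hv : (v <= hexacode_mx)%MS) :
  coloured_word Hv \in coloured.
Proof.
rewrite inE; apply/forallP=> n; rewrite hexa_liftE eqxx /=.
rewrite cardsE -sum1_card big_mkcond sum_I4 !unfold_in !hexa_liftE /=.
by elim/F4_ind4: (v 0 n).
Qed.

Lemma hexa_lift_dot (x : vec24) v :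
  \sum_k x 0 k * hexa_lift v 0 k = \sum_n trF4 (hexa x 0 n) (v 0 n).
Proof.
rewrite sum_mog4; apply: eq_bigr => n _; rewrite !hexa_liftE hexaE /trF4 /=.
ring.
Qed.

Lemma grey_basis_dot i (x : vec24) :
  \sum_k grey_basis_vec i 0 k * x 0 k = col_parity x i + row0_parity x.
Proof.
rewrite sum_mog4 /row0_parity (bigD1 i) //= [in RHS](bigD1 i) //=.
rewrite !grey_basis_vecE !eqxx /= /col_parity sum_I4.
rewrite (eq_bigr (fun n => x 0 (mog ord0 n))) => [|n /negPf ni]; last first.
  by rewrite !grey_basis_vecE ni /= !mul1r !mul0r !addr0.
rewrite !mul1r mul0r; set y := \sum_(_ | _) _.
by rewrite add0r -[LHS]addr0 -[in LHS](addF2 (x 0 (mog ord0 i))); ring.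
Qed.

(** Orthogonality to the [g_n] gives the parity conditions
    ([grey_basis_dot]), and orthogonality to the coloured words gives
    orthogonality of [hexa x] to the hexacode, which is self-dual
    ([hexa_lift_dot]). *)
Lemma golay_dual (x : vec24) :
  (forall d : code, \sum_k d 0 k * x 0 k = 0) -> x \in golay.
Proof.
move=> orth; apply/golayP; split=> [|n].
  apply: hexacode_dual => v Hv; rewrite -hexa_lift_dot.
  rewrite -[RHS](orth (coloured_word Hv)).
  by apply: eq_bigr => k _; rewrite mulrC.
apply/eqP; rewrite -subr_eq0 oppF2 -grey_basis_dot.
by rewrite (orth (grey_basis n)).
Qed.

(** Identities in the cocode are proved by pairing with all code words. *)
Lemma pairing_nondeg (delta : cocode) :
  (forall d, pairing d delta = 0) -> delta = 0.
Proof.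
have [x ->] := clsP delta => orth; apply: cls_golay.
by apply: golay_dual => d; rewrite -pairingE.
Qed.

(** * Grey and coloured words *)

Notation grey_word := (F2comb grey_basis).
Notation grey_dual_word := (F2comb grey_dual_basis).

(** [row0 d] lists the products of d with the basis of the grey cocode, and
    [grey_coord delta] those of delta with the basis of the grey code. *)
Definition row0 (x : vec24) : 'rV['F_2]_6 := \row_i x 0 (mog ord0 i).
Definition grey_coord (delta : cocode) : 'rV['F_2]_6 :=
  \row_i pairing (grey_basis i) delta.

Lemma row0D x y : row0 (x + y) = row0 x + row0 y.
Proof. by apply/rowP=> i; rewrite !mxE. Qed.

Lemma row0_code0 : row0 (codeword 0) = 0.
Proof. by apply/rowP=> i; rewrite !mxE. Qed.

Lemma row0_coloured (h : code) : h \in coloured -> row0 h = 0.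
Proof.
rewrite inE => /forallP col_h; apply/rowP=> n; rewrite !mxE.
by have /andP[/eqP] := col_h n.
Qed.

Lemma grey_wordE a m n : codeword (grey_word a) 0 (mog m n) =
  (if m == ord0 then flip a else a) 0 n.
Proof.
transitivity (\sum_i a 0 i * grey_basis_vec i 0 (mog m n)).
  rewrite /F2comb (big_morph codeword codewordD erefl) summxE.
  apply: eq_bigr => i _; elim/F2_ind: (a 0 i); rewrite /= ?mulr0n ?mulr1n.
    by rewrite mxE mul0r.
  by rewrite mul1r.
case: eqP => [-> | /eqP/negPf m0]; last first.
  rewrite (bigD1 n) //= grey_basis_vecE eqxx m0 mulr1 big1 ?addr0 // => i ni.
  by rewrite grey_basis_vecE eq_sym (negPf ni) m0 mulr0.
rewrite !mxE /tot (bigD1 n) //= [in RHS](bigD1 n) //= addrA addF2 add0r.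
rewrite grey_basis_vecE !eqxx mulr0 add0r; apply: eq_bigr => i ni.
by rewrite grey_basis_vecE eq_sym (negPf ni) eqxx mulr1.
Qed.

Lemma row0_grey_word a : row0 (grey_word a) = flip a.
Proof. by apply/rowP=> n; rewrite mxE grey_wordE. Qed.

Lemma grey_word_inj : injective grey_word.
Proof.
move=> a b eq_ab; apply/rowP=> n.
by have := grey_wordE a 1 n; rewrite eq_ab grey_wordE.
Qed.

Lemma grey_wordP a : grey_word a \in grey.
Proof.
rewrite inE; apply/forallP=> n; apply/forallP=> m1; apply/forallP=> m2.
by apply/implyP=> /andP[/negPf m1_0 /negPf m2_0]; rewrite !grey_wordE m1_0 m2_0.
Qed.

Definition row1 (x : vec24) : 'rV['F_2]_6 := \row_n x 0 (mog 1 n).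

Lemma row1_grey_word a : row1 (grey_word a) = a.
Proof. by apply/rowP=> n; rewrite mxE grey_wordE. Qed.

(** In a grey word, column parity expresses the entry in row 0 by the parity p
    of row 0 and the common entry of the other rows; summing over the
    columns determines p. *)
Lemma grey_wordK (e : code) : e \in grey -> grey_word (row1 e) = e.
Proof.
rewrite inE => grey_e.
have rows m n : m != ord0 -> e 0 (mog m n) = e 0 (mog 1 n).
  by move=> m0; have /forallP/(_ n)/forallP/(_ m)/forallP/(_ 1) := grey_e;
     rewrite m0 => /eqP.
have /golayP[_ par_e] := codewordP e.
have De0 n : e 0 (mog ord0 n) = row0_parity e + row1 e 0 n.
  rewrite -(par_e n) /col_parity sum_I4 (rows 2) // (rows 3) // addF2 add0r.
  by rewrite mxE -addrA addF2 addr0.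
have De : row0_parity e = tot (row1 e).
  rewrite /row0_parity; under eq_bigr do rewrite De0.
  rewrite big_split /= sumr_const card_ord.
  rewrite (_ : _ *+ 6 = 0) ?add0r //.
  by elim/F2_ind: (row0_parity e); apply/eqP.
apply: val_inj; apply: mog_rowP => m n; rewrite grey_wordE.
case: eqP => [-> | /eqP m0]; last by rewrite mxE rows.
by rewrite De0 De addrC !mxE.
Qed.

Lemma sum_grey (V : nmodType) (F : code -> V) :
  \sum_(e in grey) F e = \sum_a F (grey_word a).
Proof.
rewrite (reindex_onto grey_word (fun e : code => row1 e)) /=; last first.
  exact: grey_wordK.
by apply: eq_bigl => a; rewrite row1_grey_word eqxx grey_wordP.
Qed.

Lemma grey_wt_word a : grey_wt (grey_word a) = #|supp a|.
Proof. by rewrite /grey_wt (basis_support_F2comb _ grey_word_inj). Qed.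

(** Removing from d the coloured word over [hexa d] leaves a word whose columns
    have zero label sum, so that their entries in rows 1, 2, 3 agree. *)
Lemma golay_decomp (d : code) :
  exists a v (Hv : (v <= hexacode_mx)%MS), d = grey_word a + coloured_word Hv.
Proof.
have /golayP[Hd par_d] := codewordP d.
pose h := coloured_word Hd; pose e := d + h.
suff grey_e : e \in grey.
  exists (row1 e), (hexa d), Hd; rewrite grey_wordK //.
  by rewrite -addrA addcodexx addr0.
have hexa_e : hexa e = 0.
  rewrite codewordD hexaD hexa_liftK.
  by apply/rowP=> n; rewrite !mxE F4_addxx.
have De n : e 0 (mog 1 n) = e 0 (mog 3 n) /\ e 0 (mog 2 n) = e 0 (mog 3 n).
  have E := hexaE e n; rewrite hexa_e mxE in E.
  split; apply/eqP; rewrite -subr_eq0 oppF2; apply/eqP.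
    exact: esym (congr1 F4re E).
  exact: esym (congr1 F4im E).
rewrite inE; apply/forallP=> n; apply/forallP=> m1; apply/forallP=> m2.
have [E1 E2] := De n.
by elim/I4_ind: m1; elim/I4_ind: m2; rewrite ?E1 ?E2 ?eqxx ?implybT.
Qed.

Lemma grey_basisE i : grey_basis i = grey_word (indic [set i]).
Proof. by rewrite F2comb_supp indicK big_set1. Qed.

Lemma grey_dual_basisE i : grey_dual_basis i = grey_dual_word (indic [set i]).
Proof. by rewrite F2comb_supp indicK big_set1. Qed.

Lemma grey_word_full : grey_word (const_mx 1) = full_code.
Proof.
apply: val_inj; apply: mog_rowP => m n; rewrite grey_wordE /flip tot_const.
by case: ifP => _; rewrite !mxE ?addr0.
Qed.

Lemma pairing_grey_dual d a : pairing d (grey_dual_word a) = dot a (row0 d).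
Proof.
rewrite pairing_sumr; apply: eq_bigr => i _; rewrite mxE.
elim/F2_ind: (a 0 i); rewrite /= ?mulr0n ?mulr1n ?mul0r ?mul1r.
  exact: pairing0r.
exact: pairing_point.
Qed.

Lemma pairing_grey a delta :
  pairing (grey_word a) delta = dot a (grey_coord delta).
Proof.
rewrite pairing_suml; apply: eq_bigr => i _; rewrite mxE.
elim/F2_ind: (a 0 i); rewrite /= ?mulr0n ?mulr1n ?mul0r ?mul1r //.
exact: pairing0l.
Qed.

Lemma grey_coordD d e : grey_coord (d + e) = grey_coord d + grey_coord e.
Proof. by apply/rowP=> i; rewrite !mxE pairingDr. Qed.

(** The bases of the grey code and cocode are not dual to each other, but
    their matrix of products J - I is that of [flip]. *)
Lemma grey_coord_dual b : grey_coord (grey_dual_word b) = flip b.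
Proof.
apply/rowP=> i; rewrite mxE pairing_grey_dual grey_basisE row0_grey_word.
by rewrite dot_flipC dotC dot_indic1.
Qed.

Lemma grey_dual_word_inj : injective grey_dual_word.
Proof.
move=> a b eq_ab; apply: (can_inj flipK).
by rewrite -!grey_coord_dual eq_ab.
Qed.

Lemma grey_dual_wordP a : grey_dual_word a \in grey_dual.
Proof.
rewrite inE; apply/forallP=> h; apply/implyP=> col_h.
by rewrite pairing_grey_dual row0_coloured // dot0r.
Qed.

(** The difference of the two sides is orthogonal to the grey and to the
    coloured words, hence to all code words. *)
Lemma grey_dual_wordK delta : delta \in grey_dual ->
  grey_dual_word (flip (grey_coord delta)) = delta.
Proof.
rewrite inE => /forallP orth; apply/eqP; rewrite -subr_eq0; apply/eqP.
apply: pairing_nondeg => d; have [a [v [Hv ->]]] := golay_decomp d.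
have oppc (eps : cocode) : - eps = eps.
  by apply/esym/eqP; rewrite -addr_eq0 addcocodexx.
rewrite oppc !pairingDl !pairingDr pairing_grey grey_coord_dual flipK.
rewrite pairing_grey addF2 add0r pairing_grey_dual.
rewrite row0_coloured ?coloured_wordP //.
have /implyP/(_ (coloured_wordP Hv))/eqP-> := orth (coloured_word Hv).
by rewrite addr0 dot0r.
Qed.

Lemma sum_grey_dual (V : nmodType) (F : cocode -> V) :
  \sum_(eps in grey_dual) F eps = \sum_a F (grey_dual_word a).
Proof.
rewrite (reindex_onto grey_dual_word (fun eps => flip (grey_coord eps))) /=.
  by apply: eq_bigl => a; rewrite grey_coord_dual flipK eqxx grey_dual_wordP.
exact: grey_dual_wordK.
Qed.

Lemma grey_dual_wt_word a : grey_dual_wt (grey_dual_word a) = #|supp a|.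
Proof. by rewrite /grey_dual_wt (basis_support_F2comb _ grey_dual_word_inj). Qed.

Lemma gamma_word (d : code) (S : {set 'I_6}) :
  (forall n, (1 < #|[set m : 'I_4 | (m != ord0) && (d 0%R (mog m n) == 1%R)]|)%N
             = (n \in S)) ->
  gamma d = grey_dual_word (indic S).
Proof. by move=> DS; rewrite /gamma (eq_bigl _ _ DS) F2comb_supp indicK. Qed.

Lemma card_rows123 (x : vec24) n :
  #|[set m : 'I_4 | (m != ord0) && (x 0 (mog m n) == 1)]| =
  ((x 0 (mog 1 n) == 1)%R + (x 0 (mog 2 n) == 1)%R + (x 0 (mog 3 n) == 1)%R)%N.
Proof.
rewrite cardsE -sum1_card big_mkcond sum_I4 !unfold_in /=.
by do 3!case: (_ == _).
Qed.

Lemma gamma_grey a : gamma (grey_word a) = grey_dual_word a.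
Proof.
rewrite -[a in RHS]suppK; apply: gamma_word => n.
rewrite card_rows123 !grey_wordE inE /=.
by case: (_ == _).
Qed.

Definition hexa_supp (v : 'rV[F4]_6) : {set 'I_6} := [set n | v 0 n != 0].

Lemma hexacode_row_weight (c : F4) i : c != 0 ->
  #|hexa_supp (c *: hexacode_row i)| = 4%N.
Proof.
move=> nz_c; rewrite /hexa_supp cardsE -sum1_card big_mkcond sum_I6.
rewrite !unfold_in !mxE !mulf_eq0 !(negPf nz_c) /=.
by elim/I3_ind: i.
Qed.

Lemma gamma_coloured v (Hv : (v <= hexacode_mx)%MS) :
  gamma (coloured_word Hv) = grey_dual_word (indic (hexa_supp v)).
Proof.
apply: gamma_word => n; rewrite card_rows123 !hexa_liftE inE /=.
by elim/F4_ind4: (v 0 n).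
Qed.

(** For S of even size this is the union of the columns in S. *)
Definition column_word (S : {set 'I_6}) : code := grey_word (indic S).

Lemma column_wordE (S : {set 'I_6}) m n : ~~ odd #|S| ->
  column_word S 0 (mog m n) = (n \in S)%:R.
Proof.
move=> even_S; have tot_S : tot (indic S) = 0.
  rewrite tot_card indicK -(odd_double_half #|S|) (negPf even_S) add0n.
  by rewrite -muln2 natrM [X in _ * X](_ : _ = 0) ?mulr0 //; apply/eqP.
by rewrite grey_wordE /flip tot_S; case: ifP => _; rewrite !mxE ?addr0.
Qed.

(** * The Leech lattice *)

Lemma intF2_2 : (2 : int)%:~R = 0 :> 'F_2.
Proof. by apply/eqP. Qed.

Lemma intrF2_parity (x : int) :
  exists j : int, x = ((x%:~R : 'F_2) : nat)%:Z + 2 * j.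
Proof.
exists (x %/ 2)%Z; rewrite {1}(divz_eq x 2) addrC mulrC; congr (_ + _).
rewrite {2}(divz_eq x 2) intrD intrM intF2_2 mulr0 add0r.
have := modz_ge0 x (isT : 2 != 0 :> int).
have := ltz_pmod x (isT : 0 < 2 :> int).
by case: (x %% 2)%Z => [[|[|?]]|].
Qed.

Lemma intrF2_2 (a b : int) : (a + 2 * b)%:~R = a%:~R :> 'F_2.
Proof. by rewrite intrD intrM intF2_2 mul0r addr0. Qed.

Lemma eq_intrF2 (a b : int) : a%:~R = b%:~R :> 'F_2 -> exists j, a = b + 2 * j.
Proof.
move=> ab; have [[i Da] [j Db]] := (intrF2_parity a, intrF2_parity b).
by exists (i - j); rewrite Da Db ab; ring.
Qed.

Lemma const_golay (a : 'F_2) : const_mx a \in golay.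
Proof. by elim/F2_ind: a; [apply: rpred0 | apply: golay_full]. Qed.

(** Replacing the bit and the code word in the definition of the lattice by an
    integer m and an integral vector c makes the conditions additive: the code
    word is the reduction of c, and the condition on the sum of the
    coordinates m + 2 c_i becomes sum c = 2 m modulo 4, because there are 24
    of them. *)
Lemma leechP (R : realType) (u : 'rV[R]_24) :
  leech u <-> exists (m : int) (c : 'rV[int]_24) (k : int),
    [/\ u = \row_i (m + 2 * c 0 i)%:~R, map_mx intr c \in golay
      & \sum_i c 0 i = 2 * m + 4 * k].
Proof.
split=> [[z -> [m [d [Dz Dsum]]]] | [m [c [k [-> Cc Dsum]]]]].
  have Dzi i : exists j : int, z 0 i = m%:Z + 2 * ((d 0 i : nat)%:Z + 2 * j).
    have /eqP := Dz i; rewrite eqz_mod_dvd => /dvdzP[j Dj]; exists j.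
    rewrite mulrDr mulrA addrA [2 * 2 * j]mulrC -Dj; ring.
  have [j Dj] := fin_all_exists Dzi.
  pose c : 'rV[int]_24 := \row_i ((d 0 i : nat)%:Z + 2 * j i).
  have zE i : z 0 i = m%:Z + 2 * c 0 i by rewrite mxE.
  have /eqP := Dsum; rewrite eqz_mod_dvd => /dvdzP[k Dk].
  exists m, c, (k - 3 * m%:Z); split.
  - by apply/rowP=> i; rewrite [RHS]mxE -zE mxE.
  - suff -> : map_mx intr c = d by apply: codewordP.
    apply/rowP=> i; rewrite !mxE intrF2_2.
    by elim/F2_ind: (d 0 i); apply/eqP.
  apply: (mulfI (isT : 2 != 0 :> int)); move: Dk.
  under eq_bigr do rewrite zE.
  rewrite big_split /= -mulr_sumr sumr_const card_ord => Dk.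
  have -> : 2 * \sum_i c 0 i = k * 8 + 4 * m%:Z - m%:Z *+ 24.
    by rewrite -Dk; ring.
  by rewrite -mulr_natr; ring.
exists (\row_i (m + 2 * c 0 i)); first by apply/rowP=> i; rewrite !mxE.
have [j Dm] := intrF2_parity m; set b : 'F_2 := m%:~R in Dm.
have Cd : map_mx intr c + const_mx j%:~R \in golay.
  by rewrite rpredD ?const_golay.
have Db : (b : nat)%:Z = (b == 1)%:Z by elim/F2_ind: (b).
(* m = b + 2 j, so c has to be shifted by the constant j, and reduced. *)
exists (b == 1), (Code Cd); split=> [i|].
  rewrite !mxE -intrD; have [l Dl] := intrF2_parity (c 0 i + j).
  have Dc : c 0 i = (((c 0 i + j)%:~R : 'F_2) : nat)%:Z + 2 * l - j.
    by rewrite -Dl addrK.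
  apply/eqP; rewrite eqz_mod_dvd; apply/dvdzP; exists l.
  rewrite {1}Dm {1}Dc Db; ring.
apply/eqP; rewrite eqz_mod_dvd; apply/dvdzP.
under eq_bigr do rewrite mxE.
rewrite big_split /= -mulr_sumr sumr_const card_ord Dsum -mulr_natr.
exists (3 * m + k + j); rewrite -Db Dm; ring.
Qed.

Lemma col_parity_int (c : 'rV[int]_24) n :
  col_parity (map_mx intr c) n = (\sum_m c 0 (mog m n))%:~R.
Proof. by rewrite rmorph_sum; apply: eq_bigr => m _; rewrite mxE. Qed.

Lemma row0_parity_int (c : 'rV[int]_24) :
  row0_parity (map_mx intr c) = (\sum_n c 0 (mog ord0 n))%:~R.
Proof. by rewrite rmorph_sum; apply: eq_bigr => m _; rewrite mxE. Qed.

Section Leech.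

Variable R : realType.
Implicit Types u v w : 'rV[R]_24.

Lemma leechD u v : leech u -> leech v -> leech (u + v).
Proof.
move=> /leechP[m [c [k [-> Cc Sc]]]] /leechP[m' [c' [k' [-> Cc' Sc']]]].
apply/leechP; exists (m + m'), (c + c'), (k + k'); split.
- by apply/rowP=> i; rewrite !mxE -rmorphD; congr _%:~R; ring.
- by rewrite map_mxD rpredD.
under eq_bigr do rewrite mxE.
by rewrite big_split /= Sc Sc'; ring.
Qed.

Lemma leechN u : leech u -> leech (- u).
Proof.
move=> /leechP[m [c [k [-> Cc Sc]]]].
apply/leechP; exists (- m), (- c), (- k); split.
- by apply/rowP=> i; rewrite !mxE -rmorphN; congr _%:~R; ring.
- by rewrite map_mxN rpredN.
under eq_bigr do rewrite mxE.
by rewrite sumrN Sc; ring.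
Qed.

Lemma leech0 : leech (0 : 'rV[R]_24).
Proof.
apply/leechP; exists 0, 0, 0; split.
- by apply/rowP=> i; rewrite !mxE.
- by rewrite map_mx0 rpred0.
by rewrite big1 // => i _; rewrite mxE.
Qed.

Lemma mulmx_mog_block u M m n :
  (u *m mog_block M) 0 (mog m n) = \sum_k u 0 (mog k n) * M k m.
Proof.
rewrite mxE sum_mog (bigD1 n) //= [X in _ + X]big1 ?addr0.
  by apply: eq_bigr => k _; rewrite mxE !mog_colK eqxx !mog_rowK.
move=> n' /negPf nn'; rewrite big1 // => k _.
by rewrite mxE !mog_colK nn' mulr0.
Qed.

(** xi_4a is the reflection I - J/2, and xi_4b changes the sign of row 0. *)
Lemma mulmx_xi24 u m n : (u *m xi_24 R) 0 (mog m n) =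
  (if m == ord0 then -1 else 1)
  * (u 0 (mog m n) - 2^-1 * \sum_k u 0 (mog k n)).
Proof.
rewrite /xi_24 mulmxA mulmx_mog_block !sum_I4 !mulmx_mog_block !sum_I4.
by elim/I4_ind: m; rewrite !mxE /=; field.
Qed.

(** Let p be the sum of c over row 0 of the array. All column sums of c have
    the parity of p, so they are p + 2 f_n; the image of m + 2 c is then
    m' + 2 c' with m' = - (m + p), where c' is c - f_n in rows 1, 2, 3 of
    column n and m + p + f_n - c in row 0. Modulo 2 this adds to c full
    columns and a multiple of row 0, neither of which changes [hexa], and the
    condition on sum c is what makes the parities of c' agree. *)
Lemma leech_xi24 u : leech u -> leech (u *m xi_24 R).
Proof.
move=> /leechP[m [c [k [-> Cc Sc]]]].
have /golayP[Hc par_c] := Cc.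
pose p := \sum_n c 0 (mog ord0 n); pose C n := \sum_k c 0 (mog k n).
have Cp n : exists f, C n = p + 2 * f.
  by apply: eq_intrF2; rewrite -col_parity_int -row0_parity_int par_c.
have [f Df] := fin_all_exists Cp.
have sumf : \sum_n f n = m + 2 * k - 3 * p.
  apply: (mulfI (isT : 2 != 0 :> int)).
  have : \sum_n C n = 2 * m + 4 * k by rewrite -Sc sum_mog.
  under eq_bigr do rewrite Df.
  rewrite big_split /= -mulr_sumr sumr_const card_ord -mulr_natr => Dsum.
  have -> : 2 * \sum_i f i = 2 * m + 4 * k - p * 6 by rewrite -Dsum; ring.
  ring.
pose c' : 'rV[int]_24 := \row_i (let n := mog_col i in
  if mog_row i == ord0 then m + p + f n - c 0 i else c 0 i - f n).
have c'E l n : c' 0 (mog l n) =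
    if l == ord0 then m + p + f n - c 0 (mog l n) else c 0 (mog l n) - f n.
  by rewrite mxE mog_rowK mog_colK.
have C' n : \sum_l c' 0 (mog l n) = m + 2 * (p - c 0 (mog ord0 n)).
  have := Df n; rewrite /C !sum_I4 !c'E /= => Dn.
  have -> : c 0 (mog 1 n) = p + 2 * f n - c 0 (mog ord0 n) - c 0 (mog 2 n)
    - c 0 (mog 3 n) by rewrite -Dn; ring.
  ring.
have sumc'0 : \sum_n c' 0 (mog ord0 n) = m + 2 * (3 * m + p + k).
  under eq_bigr do rewrite c'E eqxx.
  rewrite sumrB big_split /= sumr_const card_ord sumf -/p -mulr_natr; ring.
apply/leechP; exists (- (m + p)), c', (2 * m + 3 * p); split.
- apply: mog_rowP => l n; rewrite mulmx_xi24.
  have -> : \sum_k0 (\row_i (m + 2 * c 0 i)%:~R) 0 (mog k0 n) =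
     (4 * m + 2 * C n)%:~R :> R.
    rewrite /C !sum_I4 !mxE -!rmorphD /=; congr _%:~R; ring.
  rewrite !mxE mog_rowK mog_colK Df.
  by case: eqP => _; rewrite !(rmorphD, rmorphM, rmorphN) /=; field.
- apply/golayP; split.
    suff -> : hexa (map_mx intr c') = hexa (map_mx intr c) by [].
    apply/rowP=> n; rewrite !hexaE.
    congr MkF4; rewrite !mxE !mog_rowK !mog_colK /= -!intrD;
    by rewrite -[RHS](intrF2_2 _ (- f n)); congr _%:~R; ring.
  by move=> n; rewrite col_parity_int row0_parity_int C' sumc'0 !intrF2_2.
rewrite sum_mog; under eq_bigr do rewrite C'.
rewrite big_split /= -mulr_sumr sumrB !sumr_const card_ord -/p; ring.
Qed.

(** On each column, xi_24 is a rotation by 120 degrees, being the product of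
    two reflections whose roots enclose an angle of 60 degrees. *)
Lemma xi24_cube u : u *m xi_24 R *m xi_24 R *m xi_24 R = u.
Proof.
apply: mog_rowP => m n; rewrite !mulmx_xi24 !sum_I4 !mulmx_xi24 !sum_I4.
rewrite !mulmx_xi24 !sum_I4 /=.
by elim/I4_ind: m => /=; field.
Qed.

End Leech.

Lemma xi24_orthogonal (R : realType) : orthogonal_for (gram24 R) (xi_24 R).
Proof.
suff o : xi_24 R *m (xi_24 R)^T = 1%:M.
  by rewrite /orthogonal_for /gram24 mul_mx_scalar -scalemxAl o scalemx1.
have trB (M : 'M[R]_4) : (mog_block M)^T = mog_block M^T.
  by apply/matrixP=> i j; rewrite !mxE eq_sym.
have mulB (M N : 'M[R]_4) : mog_block M *m mog_block N = mog_block (M *m N).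
  apply/row_matrixP=> i; rewrite row_mul; apply: mog_rowP => l j.
  rewrite mulmx_mog_block [RHS]mxE [RHS]mxE mog_colK mog_rowK.
  case: ifP => ij.
    by rewrite mxE; apply: eq_bigr => k _; rewrite !mxE mog_colK mog_rowK ij.
  by rewrite big1 // => k _; rewrite !mxE mog_colK ij mul0r.
have B1 : mog_block 1%:M = 1%:M :> 'M[R]_24.
  apply/matrixP=> i j; rewrite !mxE.
  have -> : (i == j) = (mog_row i == mog_row j) && (mog_col i == mog_col j).
    by rewrite -mog_eq !mogK.
  by case: eqP; rewrite ?andbT ?andbF.
have bb : xi_4b R *m (xi_4b R)^T = 1%:M.
  apply/matrixP=> i j; rewrite mxE sum_I4.
  by elim/I4_ind: i; elim/I4_ind: j; rewrite !mxE /=; ring.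
have aa : xi_4a R *m (xi_4a R)^T = 1%:M.
  apply/matrixP=> i j; rewrite mxE sum_I4.
  by elim/I4_ind: i; elim/I4_ind: j; rewrite !mxE /=; field.
rewrite trmx_mul !trB mulmxA -(mulmxA (mog_block _)) mulB bb B1 mulmx1.
by rewrite mulB aa B1.
Qed.

(** Since xi_24 has order 3, its inverse preserves the lattice as well. *)
Lemma in_G24_xi24 (R : realType) : in_G24 (xi_24 R).
Proof.
split=> [|u]; first exact: xi24_orthogonal.
split=> [|Lu]; first exact: leech_xi24.
by rewrite -(xi24_cube u); do 2!apply: leech_xi24.
Qed.

(** * Congruences modulo 2 Leech *)

Lemma card24_sum (x : vec24) : card24 x = (\sum_i (x 0%R i == 1%R))%N.
Proof. by rewrite /card24 cardsE -sum1_card big_mkcond. Qed.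

Lemma card24_mog (x : vec24) : card24 x = (\sum_n
  ((x 0 (mog ord0 n) == 1)%R + ((x 0 (mog 1 n) == 1)%R
   + (x 0 (mog 2 n) == 1)%R + (x 0 (mog 3 n) == 1)%R)))%N.
Proof. by rewrite card24_sum sum_mog4. Qed.

Lemma card24_grey_basis n : card24 (grey_basis n) = 8%N.
Proof.
rewrite card24_mog (bigD1 n) //= !grey_basis_vecE !eqxx /=.
rewrite (eq_bigr (fun=> 1%N)) => [|j /negPf jn]; last first.
  by rewrite !grey_basis_vecE jn.
by rewrite sum1_card cardC1 card_ord.
Qed.

Lemma card24_full_grey_basis n : card24 (grey_basis n + full_code) = 16%N.
Proof.
have E m j : (grey_basis n + full_code : code) 0 (mog m j) =
    grey_basis n 0 (mog m j) + 1 by rewrite !mxE.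
rewrite card24_mog (bigD1 n) //= !E !grey_basis_vecE !eqxx /=.
rewrite (eq_bigr (fun=> 3%N)) => [|j /negPf jn]; last first.
  by rewrite !E !grey_basis_vecE jn.
by rewrite sum_nat_const cardC1 card_ord.
Qed.

Lemma card24_column_word (S : {set 'I_6}) : ~~ odd #|S| ->
  card24 (column_word S) = (4 * #|S|)%N.
Proof.
move=> even_S; rewrite card24_mog -sum1_card big_distrr /= [RHS]big_mkcond.
by apply: eq_bigr => n _; rewrite !column_wordE //; case: (n \in S).
Qed.

Lemma card24_coloured_word v (Hv : (v <= hexacode_mx)%MS) :
  card24 (coloured_word Hv) = (2 * #|hexa_supp v|)%N.
Proof.
rewrite card24_mog -sum1_card big_distrr /= [RHS]big_mkcond.
by apply: eq_bigr => n _; rewrite !hexa_liftE inE /=; elim/F4_ind4: (v 0 n).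
Qed.

Section LeechMod2.

Variable R : realType.
Implicit Types u v w : 'rV[R]_24.

Lemma leech_eq2_refl u : leech_eq2 u u.
Proof. by exists 0; rewrite ?subrr ?mul0rn //; apply: leech0. Qed.

Lemma leech_eq2_sym u v : leech_eq2 u v -> leech_eq2 v u.
Proof.
by case=> w Lw Dw; exists (- w); [apply: leechN | rewrite mulNrn -Dw opprB].
Qed.

Lemma leech_eq2D u v u' v' :
  leech_eq2 u v -> leech_eq2 u' v' -> leech_eq2 (u + u') (v + v').
Proof.
move=> [w Lw Dw] [w' Lw' Dw']; exists (w + w'); first exact: leechD.
by rewrite mulrnDl -Dw -Dw' opprD addrACA.
Qed.

Lemma leech_eq2_trans v u w :
  leech_eq2 u v -> leech_eq2 v w -> leech_eq2 u w.
Proof.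
move=> uv vw; have := leech_eq2D uv vw; case=> x Lx Dx; exists x => //.
by rewrite -Dx opprD addrA addrK.
Qed.

Lemma leech_eq2_xi24 u v :
  leech_eq2 u v -> leech_eq2 (u *m xi_24 R) (v *m xi_24 R).
Proof.
case=> w Lw Dw; exists (w *m xi_24 R); first exact: leech_xi24.
by rewrite -mulmxBl Dw !mulr2n mulmxDl.
Qed.

Lemma leech_eq2_double u v w : leech w -> v = u + w *+ 2 -> leech_eq2 v u.
Proof. by move=> Lw ->; exists w => //; rewrite addrC addKr. Qed.

(** The vectors to which the points of the array and the code words of weight
    0 modulo 8 correspond in Leech modulo 2 Leech. *)
Definition point_vec (i : 'I_24) : 'rV[R]_24 :=
  \row_j if j == i then - 3 else 1.
Definition code_vec (d : vec24) : 'rV[R]_24 :=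
  \row_j if d 0 j == 1 then 2 else 0.

Lemma leech_point_vec i : leech (point_vec i).
Proof.
apply/leechP; exists 1, (\row_j if j == i then -2 else 0), (-1); split.
- apply/rowP=> j; rewrite !mxE; case: eqP => _; ring.
- suff -> : map_mx intr (\row_j if j == i then -2 else 0) = 0 :> vec24.
    exact: rpred0.
  by apply/rowP=> j; rewrite !mxE; case: eqP => _; apply/eqP.
rewrite (bigD1 i) //= mxE eqxx big1 // => j /negPf ji.
by rewrite mxE ji.
Qed.

Lemma leech_code_vec (d : code) : (4 %| card24 d)%N -> leech (code_vec d).
Proof.
case/dvdnP=> k Dk; apply/leechP.
exists 0, (\row_j (d 0 j == 1)%:Z), k%:Z; split.
- by apply/rowP=> j; rewrite !mxE; case: eqP => _; rewrite add0r.
- suff -> : map_mx intr (\row_j (d 0 j == 1)%:Z) = d by apply: codewordP.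
  by apply/rowP=> j; rewrite !mxE; elim/F2_ind: (d 0 j); apply/eqP.
under eq_bigr do rewrite mxE.
rewrite mulr0 add0r -[RHS]/((4 * k)%:Z) mulnC -Dk card24_sum.
by rewrite (big_morph Posz PoszD (erefl 0%:Z)).
Qed.

Lemma row_addE u v k : (u + v) 0 k = u 0 k + v 0 k.
Proof. by rewrite mxE. Qed.

Lemma row_mul2nE u k : (u *+ 2) 0 k = u 0 k *+ 2.
Proof. by rewrite !mulr2n mxE. Qed.

Lemma point_vecE m n l j : point_vec (mog m n) 0 (mog l j) =
  if (l == m) && (j == n) then -3 else 1.
Proof. by rewrite mxE mog_eq. Qed.

Lemma code_vecE (d : code) k : code_vec d 0 k = if d 0 k == 1 then 2 else 0.
Proof. by rewrite mxE. Qed.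

Definition leechE := (row_addE, row_mul2nE, mulmx_xi24, point_vecE, code_vecE).

Lemma row0_point_xi24 n :
  leech_eq2 (code_vec (grey_basis n) + point_vec (mog ord0 n))
            (point_vec (mog ord0 n) *m xi_24 R).
Proof.
apply: (leech_eq2_double (leech_point_vec (mog ord0 n))).
apply: mog_rowP => l j; rewrite !leechE sum_I4 !leechE grey_basis_vecE.
by elim/I4_ind: l => /=; case: (j == n) => /=; field.
Qed.

Lemma grey_basis_xi24 n :
  leech_eq2 (point_vec (mog ord0 n)) (code_vec (grey_basis n) *m xi_24 R).
Proof.
apply: (leech_eq2_double (leech_point_vec (mog ord0 n))).
apply: mog_rowP => l j; rewrite !leechE sum_I4 !leechE !grey_basis_vecE.
by elim/I4_ind: l => /=; case: (j == n) => /=; field.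
Qed.

Lemma point_xi24 m n : m != ord0 ->
  leech_eq2 (code_vec (grey_basis n + full_code) + point_vec (mog m n))
            (point_vec (mog m n) *m xi_24 R).
Proof.
move=> nz_m; have E l j : (grey_basis n + full_code : code) 0 (mog l j) =
    grey_basis n 0 (mog l j) + 1 by rewrite !mxE.
have L : leech (code_vec (grey_basis n + full_code)).
  by apply: leech_code_vec; rewrite card24_full_grey_basis.
apply: (leech_eq2_double L).
apply: mog_rowP => l j; rewrite !leechE sum_I4 !leechE !E !grey_basis_vecE.
elim/I4_ind: m nz_m => // _; elim/I4_ind: l => /=;
by case: (j == n) => /=; field.
Qed.

(** The two sides differ by twice the vector w with columns (0, 4, 4, 4) on S
    and (2, 2, 2, 2) elsewhere, which is in the lattice because the union of
    the two columns not in S is a code word. *)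
Lemma coloured_xi24 (v : 'rV[F4]_6) (Hv : (v <= hexacode_mx)%MS)
    (S := hexa_supp v) :
    #|S| = 4%N ->
  leech_eq2 (code_vec (coloured_word Hv) + (code_vec (column_word S)
               + \sum_(n in S) point_vec (mog ord0 n)))
            (code_vec (coloured_word Hv) *m xi_24 R).
Proof.
move=> S4.
pose w : 'rV[R]_24 := \row_k (if mog_col k \in S then
   if mog_row k == ord0 then 0 else 4 else 2).
have wE m n : w 0 (mog m n) =
    if n \in S then if m == ord0 then 0 else 4 else 2.
  by rewrite mxE mog_rowK mog_colK.
have even_S : ~~ odd #|S| by rewrite S4.
have Lw : leech w.
  pose c : 'rV[int]_24 := \row_k (if mog_col k \in S then
     if mog_row k == ord0 then 0 else 2 else 1).
  apply/leechP; exists 0, c, 8; split.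
  - by apply/rowP=> k; rewrite !mxE; do 2?case: ifP => _; rewrite add0r.
  - suff -> : map_mx intr c = column_word S + full_code by apply: codewordP.
    apply: mog_rowP => m n; rewrite codewordD [RHS]mxE column_wordE //.
    rewrite !mxE mog_rowK mog_colK.
    by do 2?case: ifP => _; apply/eqP.
  rewrite sum_mog (eq_bigr (fun n => if n \in S then 6 else 4)) => [|n _].
    rewrite (bigID (mem S)) /= (eq_bigr (fun=> 6)) => [|n ->] //.
    rewrite [X in _ + X](eq_bigr (fun=> 4)) => [|n /negPf->] //.
    rewrite !sumr_const S4 (_ : #|_| = 2%N) //.
    by have := cardC (mem S); rewrite card_ord S4 => -[].
  by rewrite sum_I4 !mxE !mog_rowK !mog_colK /=; case: (n \in S).
apply: (leech_eq2_double Lw).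
apply: mog_rowP => l j; rewrite !leechE wE sum_I4 !leechE column_wordE //.
have -> : (\sum_(n in S) point_vec (mog ord0 n)) 0 (mog l j) =
    if (j \in S) && (l == ord0) then 0 else 4.
  have sum1S : \sum_(n in S) 1 = 4 :> R by rewrite sumr_const S4.
  rewrite summxE (eq_bigr _ (fun n _ => point_vecE ord0 n l j)).
  have [_ | _] := eqVneq l ord0; last by rewrite andbF.
  rewrite andbT; case: ifP => Sj.
    rewrite (bigD1 j) //= eqxx (eq_bigr (fun=> 1)) => [|n /andP[_ nj]].
      by move: sum1S; rewrite (bigD1 j) //= => sum1S; lra.
    by rewrite eq_sym (negPf nj).
  rewrite -[RHS]sum1S; apply: eq_bigr => n Sn.
  by case: eqP => // jn; rewrite jn Sn in Sj.
rewrite !hexa_liftE inE /=.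
by elim/I4_ind: l => /=; elim/F4_ind4: (v 0 j) => /=; field.
Qed.

End LeechMod2.

(** * The normal form of the elements of Q_x *)

Lemma meet24C (x y : vec24) : meet24 x y = meet24 y x.
Proof. by apply/rowP=> i; rewrite !mxE mulrC. Qed.

Section Extraspecial.

Variables (theta : code -> code -> 'F_2) (theta' : code -> cocode).
Hypothesis Htheta : parker_cocycle theta theta'.

Lemma theta_0l d : theta 0 d = 0.
Proof.
have := theta_addl Htheta 0 0 d; rewrite addr0 addF2 add0r => ->.
by rewrite /loopA card24E big1 // => i _; rewrite !mxE !mul0r.
Qed.

Lemma theta_0r d : theta d 0 = 0.
Proof. by have := theta_addr Htheta d 0 0; rewrite addr0 addF2. Qed.

(** Additivity of theta up to A, read in the cocode by nondegeneracy of the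
    pairing. *)
Lemma theta'D d e : theta' (d + e) = theta' d + theta' e + loopA2 d e.
Proof.
apply/eqP; rewrite -subr_eq0; apply/eqP.
have oppc (eps : cocode) : - eps = eps.
  by apply/esym/eqP; rewrite -addr_eq0 addcocodexx.
apply: pairing_nondeg => f; rewrite oppc !pairingDr !(pairing_theta Htheta).
rewrite (theta_addl Htheta) pairing_cls meet24C; apply: addF2.
Qed.

Lemma theta'_grey_basis n : theta' (grey_basis n) = 0.
Proof.
rewrite grey_basisE (theta_grey Htheta) ?grey_wordP //.
by rewrite grey_wt_word indicK cards1 subrr mulr0z add0r.
Qed.

Lemma theta'_full_grey_basis n : theta' (grey_basis n + full_code) = 0.
Proof. by rewrite (theta_full Htheta) theta'_grey_basis. Qed.

Lemma theta'_column_word (S : {set 'I_6}) : #|S| = 4%N ->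
  theta' (column_word S) = \sum_(n in S) grey_dual_basis n.
Proof.
move=> S4; rewrite (theta_grey Htheta) ?grey_wordP //.
rewrite grey_wt_word indicK S4 gamma_grey F2comb_supp indicK.
rewrite (_ : w2 4 = 0) ?mulr0n ?addr0; last exact/eqP.
by rewrite (_ : 4%:Z - 1 = 3%:Z) // -pmulrn mulrSr mulr2n addcocodexx add0r.
Qed.

(** Of theta of a coloured word h, only its products with grey words are
    determined by the axioms; they are those of gamma(h). *)
Lemma grey_coord_theta' v (Hv : (v <= hexacode_mx)%MS) :
  grey_coord (theta' (coloured_word Hv)) = flip (indic (hexa_supp v)).
Proof.
rewrite -grey_coord_dual -(gamma_coloured Hv); apply/rowP=> i; rewrite !mxE.
rewrite (pairing_theta Htheta) (theta_coloured_grey Htheta) ?coloured_wordP //.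
by rewrite grey_basisE grey_wordP.
Qed.

Variables (gT : finGroupType) (xP : parker_loop -> gT) (xC : cocode -> gT).
Hypothesis HQ : is_Qx theta xP xC.

(** [z] is the central element x_{-1}. *)
Local Notation z := (xP parker_m1).
Local Notation tx := (tilde_x theta' xP xC).

Lemma xC0 : xC 0 = 1%g.
Proof. by have := Qx_mulC HQ 0 0; rewrite addr0 -[RHS]mulg1 => /mulgI. Qed.

Lemma xC2 delta : (xC delta * xC delta = 1)%g.
Proof. by rewrite (Qx_mulC HQ) addcocodexx xC0. Qed.

Lemma zC g : (z * g = g * z)%g.
Proof. exact: (Qx_central HQ g). Qed.

Lemma zXC (a : 'F_2) g : (z ^+ a * g = g * z ^+ a)%g.
Proof. exact: (commute_sym (commuteX a (commute_sym (Qx_central HQ g)))). Qed.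

Lemma z2 : (z ^+ 2 = 1)%g.
Proof.
rewrite (Qx_sqrP HQ) -(theta_diag Htheta) theta_0l; exact: expg0.
Qed.

Lemma zXD (a b : 'F_2) : (z ^+ a * z ^+ b = z ^+ (a + b)%R)%g.
Proof.
elim/F2_ind: a; first by rewrite add0r expg0 mul1g.
elim/F2_ind: b; first by rewrite addr0 expg0 mulg1.
exact: z2.
Qed.

Lemma xP_split d a : xP (d, a) = (xP (d, 0%R) * z ^+ a)%g.
Proof.
elim/F2_ind: a; first by rewrite expg0 mulg1.
rewrite expg1 (Qx_mulP HQ) /parker_mul /= addr0 add0r theta_0r addr0.
have -> : loopA2 d 0 = 0; last by rewrite xC0 mulg1.
rewrite -cls0; congr cls; apply/rowP=> i.
by rewrite !mxE mulr0.
Qed.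

Lemma xP_mul d e :
  (xP (d, 0%R) * xP (e, 0%R) =
     xP (d + e, 0)%R * z ^+ theta d e * xC (loopA2 d e))%g.
Proof. by rewrite (Qx_mulP HQ) /parker_mul /= !add0r -xP_split. Qed.

Lemma xPC d delta :
  (xC delta * xP d = xP d * xC delta * z ^+ pairing d.1 delta)%g.
Proof.
rewrite [(xP d * _)%g]commgC (Qx_commPC HQ) -mulgA zXD addF2.
by rewrite expg0 mulg1.
Qed.

Lemma txE d : tx d = (xP (d, 0%R) * xC (theta' d))%g.
Proof. by []. Qed.

Lemma xC_tx d delta :
  (xC delta * tx d = tx d * xC delta * z ^+ pairing d delta)%g.
Proof.
rewrite !txE mulgA xPC /= -!mulgA zXC.
by rewrite !mulgA -(mulgA _ (xC delta)) -(mulgA _ (xC (theta' d)) (xC delta))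
   !(Qx_mulC HQ) addrC.
Qed.

(** Exchanging [x_theta(d)] and [x_e] produces z to the power theta(d, e),
    which cancels the one from the product in the Parker loop; the factor
    [x_A(d, e)] is absorbed by [theta'D]. *)
Lemma txD d e : (tx d * tx e = tx (d + e))%g.
Proof.
rewrite [in LHS]txE -mulgA.
have -> : (xC (theta' d) * tx e = tx e * xC (theta' d) * z ^+ theta d e)%g.
  by rewrite xC_tx (pairing_theta Htheta).
rewrite mulgA mulgA txE [X in (X * _ * _)%g]mulgA xP_mul.
rewrite txE theta'D -!(Qx_mulC HQ) -!mulgA; congr (_ * _)%g.
rewrite !mulgA -[LHS]zXC !mulgA zXD addF2 expg0 mul1g !(Qx_mulC HQ).
by congr (xC _); rewrite addrC [loopA2 _ _ + _]addrC addrA.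
Qed.

Lemma tx0 : tx 0 = 1%g.
Proof. by have := txD 0 0; rewrite addr0 -[RHS]mulg1 => /mulgI. Qed.

(** The normal form of an element of Q_x, up to the centre. *)
Definition heis d delta : gT := (tx d * xC delta)%g.

Lemma heisMz d delta (a : 'F_2) e eps (b : 'F_2) :
  ((heis d delta * z ^+ a) * (heis e eps * z ^+ b) =
   heis (d + e) (delta + eps) * z ^+ (pairing e delta + a + b)%R)%g.
Proof.
(* Abstracting from tx keeps the regrouping of products from unfolding it. *)
rewrite /heis; move: (xC_tx e delta) (txD d e).
move: (tx d) (tx e) (tx (d + e)) => u v w delta_v uv.
rewrite -!mulgA (mulgA (z ^+ a)%g) zXC -!mulgA (mulgA (xC delta)) delta_v.
rewrite -!mulgA (mulgA (z ^+ _)%g) zXD (mulgA (z ^+ _)%g) zXC -!mulgA zXD.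
by rewrite (mulgA (xC delta)) (Qx_mulC HQ) (mulgA u) uv.
Qed.

Lemma heisM d delta e eps : (heis d delta * heis e eps =
   heis (d + e) (delta + eps) * z ^+ pairing e delta)%g.
Proof. by have := heisMz d delta 0 e eps 0; rewrite !addr0 !expg0 !mulg1. Qed.

Lemma heis_xP d : heis d (theta' d) = xP (d, 0).
Proof. by rewrite /heis txE -mulgA xC2 mulg1. Qed.

Lemma heis0 delta : heis 0 delta = xC delta.
Proof. by rewrite /heis tx0 mul1g. Qed.

Lemma heis00 : heis 0 0 = 1%g.
Proof. by rewrite heis0 xC0. Qed.

Lemma heisP q : exists d delta (a : 'F_2), q = (heis d delta * z ^+ a)%g.
Proof.
have : q \in <<(xP @: setT) :|: (xC @: setT)>>%g by rewrite (Qx_gen HQ) inE.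
case/gen_prodgP=> k [c Ac ->]; elim: k c Ac => [|k IHk] c Ac.
  by exists 0, 0, 0; rewrite big_ord0 heis00 expg0 mulg1.
rewrite big_ord_recl; set q' := (\prod_(i < k) _)%g.
have [d [delta [a ->]]] : exists d delta (a : 'F_2),
    q' = (heis d delta * z ^+ a)%g by apply: IHk => i.
have [e [eps [b ->]]] : exists d delta (a : 'F_2),
    c ord0 = (heis d delta * z ^+ a)%g.
  have := Ac ord0; rewrite inE => /orP[] /imsetP[].
    by case=> e b _ ->; exists e, (theta' e), b; rewrite heis_xP -xP_split.
  by move=> eps _ ->; exists 0, eps, 0; rewrite heis0 expg0 mulg1.
by exists (e + d), (eps + delta), (pairing d eps + b + a); rewrite heisMz.
Qed.

(** * Conjugation by xi in the representation 4096_x *)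

Section Representation.

Variables (R : realType) (N : nat) (rho : mx_representation R [set: gT] N).
Hypothesis N_gt1 : (1 < N)%N.
Hypotheses (rho_faithful : mx_faithful rho) (rho_irr : mx_irreducible rho).

Local Notation Rm d delta := (rho (heis d delta)).
Local Notation xi_gamma := (xi_gamma xC rho).
Local Notation xi_g := (xi_g theta' xP xC rho).
Local Notation xi := (xi theta' xP xC rho).

Lemma rhoM g h : rho (g * h)%g = rho g *m rho h.
Proof. by rewrite repr_mxM ?inE. Qed.

Lemma rho_inj : injective rho.
Proof. by move=> g h; apply: (mx_faithful_inj rho_faithful); rewrite inE. Qed.

(** By Schur's lemma, X - 1 is zero or invertible, while
    (X - 1) (X + 1) = 0. *)
Lemma central_involution_scalar (X : 'M[R]_N) :
  (forall g, X *m rho g = rho g *m X) -> X *m X = 1%:M ->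
  X = 1%:M \/ X = - 1%:M.
Proof.
move=> centX X2; have cent : centgmx rho (X - 1%:M).
  apply/centgmxP=> g _; rewrite mulmxBl mulmxBr centX.
  by rewrite mul1mx mulmx1.
have [/eqP | nz] := eqVneq (X - 1%:M) 0; first by rewrite subr_eq0 => /eqP; left.
right; have uX := mx_Schur rho_irr cent nz.
have : (X - 1%:M) *m (X + 1%:M) = 0.
  by rewrite mulmxBl mulmxDr X2 mulmx1 mul1mx [1%:M + X]addrC subrr.
move/(congr1 (mulmx (invmx (X - 1%:M)))); rewrite mulmx0 mulKmx // => /eqP.
by rewrite addr_eq0 => /eqP.
Qed.

(** If z were 1 then Q_x would be elementary abelian. All its elements would
    act as 1 or -1, so that every line would be invariant, and the
    representation would have dimension 1. *)
Lemma z_neq1 : z != 1%g.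
Proof.
apply/eqP=> z1.
have abel (g h : gT) : (g * h = h * g)%g.
  have [d [delta [a ->]]] := heisP g.
  have [e [eps [b ->]]] := heisP h.
  by rewrite !heisMz z1 !expg1n [d + e]addrC [delta + eps]addrC.
have invol (g : gT) : (g * g = 1)%g.
  have [d [delta [a ->]]] := heisP g.
  by rewrite heisMz z1 expg1n addcodexx addcocodexx heis00 mulg1.
have [_ _ irr] := rho_irr.
pose i0 := Ordinal (ltnW N_gt1); pose U : 'M[R]_N := delta_mx i0 i0.
have modU : mxmodule rho U.
  apply/mxmoduleP=> g _.
  case: (@central_involution_scalar (rho g)) => [h | | -> | ->].
  - by rewrite -!rhoM abel.
  - by rewrite -rhoM invol repr_mx1.
  - by rewrite mulmx1.
  - by rewrite mulmxN mulmx1 eqmx_opp.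
have Ur : \rank U = 1%N by rewrite mxrank_delta.
have /mxrankS : (1%:M <= U)%MS by apply: irr; rewrite ?submx1 -?mxrank_eq0 ?Ur.
by rewrite mxrank1 Ur leqNgt N_gt1.
Qed.

Lemma rho_z : rho z = - 1%:M.
Proof.
case: (@central_involution_scalar (rho z)) => [g | | z1 | //].
- by rewrite -!rhoM zC.
- by rewrite -rhoM -expg2 z2 repr_mx1.
by case/eqP: z_neq1; apply: rho_inj; rewrite z1 repr_mx1.
Qed.

Lemma rho_zX (g : gT) (a : 'F_2) : rho (g * z ^+ a)%g = (-1) ^+ a *: rho g.
Proof.
elim/F2_ind: a; first by rewrite expg0 mulg1 expr0 scale1r.
by rewrite expg1 rhoM rho_z mulmxN mulmx1 expr1 scaleN1r.
Qed.

Lemma RmM d delta e eps : Rm d delta *m Rm e eps =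
   (-1) ^+ pairing e delta *: Rm (d + e) (delta + eps).
Proof. by rewrite -rhoM heisM rho_zX. Qed.

Lemma Rm0 : Rm 0 0 = 1%:M.
Proof. by rewrite heis00 repr_mx1. Qed.

(** The two elementary abelian groups that are summed in xi_gamma and
    xi_g. *)
Let s_gamma a := Rm 0 (grey_dual_word a).
Let s_g a := Rm (grey_word a) 0.

Lemma s_gamma0 : s_gamma 0 = 1%:M.
Proof. by rewrite /s_gamma F2comb0 Rm0. Qed.

Lemma s_g0 : s_g 0 = 1%:M.
Proof. by rewrite /s_g F2comb0 Rm0. Qed.

Lemma s_gammaD a b : s_gamma (a + b) = s_gamma a *m s_gamma b.
Proof. by rewrite RmM pairing0l expr0 scale1r addr0 -(F2combD _ _ _ addcocodexx). Qed.

Lemma s_gD a b : s_g (a + b) = s_g a *m s_g b.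
Proof. by rewrite RmM pairing0r expr0 scale1r addr0 -(F2combD _ _ _ addcodexx). Qed.

Lemma xi_gammaE : xi_gamma = gauss s_gamma.
Proof.
rewrite /Defs.xi_gamma sum_grey_dual; congr (_ *: _); apply: eq_bigr => a _.
by rewrite grey_dual_wt_word /s_gamma heis0.
Qed.

Lemma xi_gE : xi_g = gauss s_g.
Proof.
rewrite /Defs.xi_g sum_grey; congr (_ *: _); apply: eq_bigr => a _.
by rewrite grey_wt_word /s_g /heis xC0 mulg1.
Qed.

Lemma xi_gammaK : xi_gamma *m xi_gamma = 1%:M.
Proof. by rewrite xi_gammaE gaussK ?s_gamma0 //; apply: s_gammaD. Qed.

Lemma xi_gK : xi_g *m xi_g = 1%:M.
Proof. by rewrite xi_gE gaussK ?s_g0 //; apply: s_gD. Qed.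

(** The commutator of [tilde_x d * x_delta] and [x_epsilon], epsilon grey, is
    z to the power the pairing of d and epsilon, a linear form in the
    coefficients of epsilon whose coefficients are [row0 d]. *)
Lemma xi_gamma_conj d delta : exists a : 'F_2,
  xi_gamma *m Rm d delta *m xi_gamma =
  rho (heis d (delta + grey_dual_word (flip (row0 d))) * z ^+ a)%g.
Proof.
exists (q6 (flip (row0 d))); rewrite rho_zX xi_gammaE.
rewrite (gauss_conj s_gammaD (l := row0 d)) => [|a]; last first.
  rewrite !RmM pairing0l expr0 scale1r add0r addr0 pairing_grey_dual scalerA.
  by rewrite -signF2D addF2 scale1r [delta + _]addrC.
rewrite -scalemxAl -!mulmxA (gaussK s_gamma0 s_gammaD) mulmx1 RmM.
by rewrite pairing0l expr0 scale1r addr0.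
Qed.

(** All the [tilde_x e] commute with each other, so here only delta matters,
    through its products with the grey words. *)
Lemma xi_g_conj d delta : exists a : 'F_2,
  xi_g *m Rm d delta *m xi_g =
  rho (heis (d + grey_word (flip (grey_coord delta))) delta * z ^+ a)%g.
Proof.
exists (q6 (flip (grey_coord delta)) +
        pairing (grey_word (flip (grey_coord delta))) delta).
rewrite rho_zX xi_gE.
rewrite (gauss_conj s_gD (l := grey_coord delta)) => [|a]; last first.
  rewrite !RmM pairing0r expr0 scale1r add0r addr0 pairing_grey.
  by rewrite [d + _]addrC.
rewrite -scalemxAl -!mulmxA (gaussK s_g0 s_gD) mulmx1 RmM.
by rewrite addr0 scalerA signF2D.
Qed.

(** The effect of conjugation by xi on a normal form. It is applied from the
    right, so that xi_gamma, the left factor of xi, acts first. *)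
Definition act_delta (d : code) (delta : cocode) : cocode :=
  delta + grey_dual_word (flip (row0 d)).
Definition act_code (d : code) (delta : cocode) : code :=
  d + grey_word (flip (grey_coord (act_delta d delta))).
Definition act d delta : gT := heis (act_code d delta) (act_delta d delta).

Lemma xi_inv : invmx xi = xi_g *m xi_gamma.
Proof.
have xiK : xi *m (xi_g *m xi_gamma) = 1%:M.
  by rewrite /Defs.xi mulmxA -(mulmxA xi_gamma) xi_gK mulmx1 xi_gammaK.
have [uxi _] := mulmx1_unit xiK.
by rewrite -[RHS](mulKmx uxi) xiK mulmx1.
Qed.

Lemma conj_zX (u v : 'M[R]_N) g h (a b : 'F_2) :
  u *m rho g *m v = rho (h * z ^+ b)%g ->
  u *m rho (g * z ^+ a)%g *m v = rho (h * z ^+ (a + b)%R)%g.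
Proof.
move=> guv; rewrite rho_zX -scalemxAr -scalemxAl guv.
by rewrite !rho_zX scalerA signF2D.
Qed.

Lemma xi_conj d delta (a : 'F_2) : exists b : 'F_2,
  invmx xi *m rho (heis d delta * z ^+ a)%g *m xi =
  rho (act d delta * z ^+ b)%g.
Proof.
have [b Db] := xi_gamma_conj d delta.
have [c Dc] := xi_g_conj d (act_delta d delta).
exists (a + b + c).
have -> X : invmx xi *m X *m xi = xi_g *m (xi_gamma *m X *m xi_gamma) *m xi_g.
  by rewrite xi_inv !mulmxA.
by rewrite (conj_zX a Db) (conj_zX (a + b) Dc).
Qed.

(** Both involutions map Q_x into itself under conjugation, and so does their
    product in either order. *)
Lemma xi_normalizes : normalizes rho xi.
Proof.
have stab_gamma q : exists r, xi_gamma *m rho q *m xi_gamma = rho r.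
  have [d [delta [a ->]]] := heisP q.
  have [b /conj_zX->] := xi_gamma_conj d delta.
  by eexists.
have stab_g q : exists r, xi_g *m rho q *m xi_g = rho r.
  have [d [delta [a ->]]] := heisP q.
  have [b /conj_zX->] := xi_g_conj d delta.
  by eexists.
move=> X; rewrite xi_inv /Defs.xi; split=> [[q ->] | [q Dq]].
  have [r Dr] := stab_gamma q; have [s Ds] := stab_g r.
  by exists s; rewrite -Ds -Dr !mulmxA.
have [r Dr] := stab_g q; have [s Ds] := stab_gamma r; exists s.
rewrite -Ds -Dr -Dq !mulmxA.
rewrite -(mulmxA xi_gamma) xi_gK mulmx1 xi_gammaK mul1mx.
by rewrite -(mulmxA _ xi_g xi_g) xi_gK mulmx1 -mulmxA xi_gammaK mulmx1.
Qed.

Lemma xi_orthogonal (B : 'M[R]_N) :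
  (forall q : gT, orthogonal_for B (rho q)) -> orthogonal_for B xi.
Proof.
move=> Binv.
have og : orthogonal_for B xi_gamma.
  rewrite xi_gammaE; apply: gauss_orthogonal => [||a].
  - exact: s_gamma0.
  - exact: s_gammaD.
  exact: Binv.
have oh : orthogonal_for B xi_g.
  rewrite xi_gE; apply: gauss_orthogonal => [||a].
  - exact: s_g0.
  - exact: s_gD.
  exact: Binv.
rewrite /orthogonal_for /Defs.xi trmx_mul !mulmxA.
by rewrite -(mulmxA xi_gamma) -(mulmxA xi_gamma) oh.
Qed.

(** * The action of xi on Leech modulo 2 Leech *)

Variable iota : gT -> 'rV[R]_24.
Hypothesis Hiota : leech_iso xP xC iota.

Local Notation "u =L v" := (leech_eq2 u v) (at level 70).

Lemma iota_zX g (a : 'F_2) : iota (g * z ^+ a)%g =L iota g.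
Proof.
apply: leech_eq2_trans (leech_isoM Hiota _ _) _.
rewrite -[X in _ =L X]addr0; apply: leech_eq2D (leech_eq2_refl _) _.
apply/(leech_iso_ker Hiota).
by elim/F2_ind: a; rewrite ?expg0 ?expg1 !inE eqxx ?orbT.
Qed.

Lemma iota_heisD d delta e eps : iota (heis (d + e) (delta + eps)) =L
  iota (heis d delta) + iota (heis e eps).
Proof.
apply: leech_eq2_trans (leech_isoM Hiota _ _); apply: leech_eq2_sym.
rewrite heisM; exact: iota_zX.
Qed.

(** Conjugation by xi and xi_24 agree at the class of
    [tilde_x d * x_delta]. *)
Definition compatible d delta : Prop :=
  iota (act d delta) =L iota (heis d delta) *m xi_24 R.

Lemma act_deltaD d delta e eps :
  act_delta (d + e) (delta + eps) = act_delta d delta + act_delta e eps.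
Proof.
rewrite /act_delta (codewordD d e) (row0D d e) flipD (F2combD _ _ _ addcocodexx).
exact: addrACA.
Qed.

Lemma act_codeD d delta e eps :
  act_code (d + e) (delta + eps) = act_code d delta + act_code e eps.
Proof.
rewrite /act_code act_deltaD grey_coordD flipD (F2combD _ _ _ addcodexx).
exact: addrACA.
Qed.

Lemma compatibleD d delta e eps :
  compatible d delta -> compatible e eps -> compatible (d + e) (delta + eps).
Proof.
rewrite /compatible /act act_codeD act_deltaD => comp_d comp_e.
apply: leech_eq2_trans (iota_heisD _ _ _ _) _.
apply: leech_eq2_trans (leech_eq2D comp_d comp_e) _.
rewrite -mulmxDl; apply/leech_eq2_xi24/leech_eq2_sym/iota_heisD.
Qed.

Lemma iota_heis00 : iota (heis 0 0) =L 0.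
Proof.
by apply/(leech_iso_ker Hiota); rewrite heis00 !inE eqxx.
Qed.

Lemma compatible00 : compatible 0 0.
Proof.
have coord0 : grey_coord 0 = 0.
  by apply/rowP=> i; rewrite !mxE; apply: pairing0r.
rewrite /compatible /act /act_code /act_delta row0_code0 flip0 F2comb0 addr0.
rewrite coord0 flip0 F2comb0 addr0.
apply: leech_eq2_trans iota_heis00 _; apply: leech_eq2_sym.
by rewrite -(mul0mx _ (xi_24 R)); apply/leech_eq2_xi24/iota_heis00.
Qed.

Lemma iota_point m n :
  iota (xC (cls (delta_mx 0 (mog m n)))) =L point_vec R (mog m n).
Proof. exact: (leech_iso_point Hiota). Qed.

Lemma iota_heis_code (d : code) delta : theta' d = 0 ->
  (card24 d = 0 %[mod 8])%N ->
  iota (heis d delta) =L code_vec R d + iota (xC delta).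
Proof.
move=> th0 d8; apply: leech_eq2_trans (leech_isoM Hiota _ _) _.
apply: leech_eq2D (leech_eq2_refl _).
rewrite txE th0 xC0 mulg1; exact: (leech_iso_code0 Hiota (d := (d, 0))).
Qed.

(** Modulo the centre, the point in row 0 of column n goes to its product with
    [g_n], and a point in another row of column n to its product with the code
    word g_n + Omega; theta vanishes on both code words. *)
Lemma compatible_point m n : compatible 0 (cls (delta_mx 0 (mog m n))).
Proof.
set delta := cls _.
have act_d : act_delta 0 delta = delta.
  by rewrite /act_delta row0_code0 flip0 F2comb0 addr0.
rewrite /compatible /act /act_code act_d add0r heis0.
apply: leech_eq2_trans (leech_eq2_xi24 (leech_eq2_sym (iota_point m n))).
have [m0 | nz_m] := eqVneq m ord0.
  have -> : grey_word (flip (grey_coord delta)) = grey_basis n.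
    rewrite /delta m0 -/(grey_dual_basis n) grey_dual_basisE grey_coord_dual.
    by rewrite flipK -grey_basisE.
  apply: leech_eq2_trans (iota_heis_code _ (theta'_grey_basis n) _) _.
    by rewrite card24_grey_basis.
  rewrite /delta m0.
  apply: leech_eq2_trans (row0_point_xi24 R n).
  exact: leech_eq2D (leech_eq2_refl _) (iota_point _ _).
have -> : grey_word (flip (grey_coord delta)) = grey_basis n + full_code.
  rewrite -grey_word_full grey_basisE -F2combD; last exact: addcodexx.
  congr (F2comb _ _); rewrite /flip; have -> : grey_coord delta = indic [set n].
    apply/rowP=> i; rewrite !mxE in_set1 pairing_point grey_basis_vecE nz_m.
    by rewrite (negPf nz_m) eq_sym; case: eqP.
  by rewrite tot_card indicK cards1.
apply: leech_eq2_trans (iota_heis_code _ (theta'_full_grey_basis n) _) _.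
  by rewrite card24_full_grey_basis.
apply: leech_eq2_trans (point_xi24 R n nz_m).
exact: leech_eq2D (leech_eq2_refl _) (iota_point _ _).
Qed.

Lemma compatible_cocode delta : compatible 0 delta.
Proof.
have [x ->] := clsP delta; rewrite [x]row_sum_delta.
elim/big_ind: _ => [|u v|k _].
- by rewrite cls0; apply: compatible00.
- by rewrite clsD -{3}(addr0 0); apply: compatibleD.
elim/F2_ind: (x 0 k); first by rewrite scale0r cls0; apply: compatible00.
by rewrite scale1r -(mogK k); apply: compatible_point.
Qed.

(** Modulo the centre, xi_gamma maps [x_{g_n}] to its product with
    [x_{gamma_n}], and then xi_g removes the first factor. *)
Lemma compatible_grey_basis n : compatible (grey_basis n) 0.
Proof.
have act_d : act_delta (grey_basis n) 0 = grey_dual_basis n.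
  rewrite /act_delta [in row0 _]grey_basisE row0_grey_word flipK add0r.
  by rewrite -grey_dual_basisE.
rewrite /compatible /act /act_code act_d [in flip _]grey_dual_basisE.
rewrite grey_coord_dual flipK -grey_basisE addcodexx heis0.
apply: leech_eq2_trans (iota_point _ _) _.
apply: leech_eq2_trans (grey_basis_xi24 R n) _; apply: leech_eq2_xi24.
apply: leech_eq2_sym.
apply: leech_eq2_trans (iota_heis_code _ (theta'_grey_basis n) _) _.
  by rewrite card24_grey_basis.
rewrite -[X in _ =L X]addr0; apply: leech_eq2D (leech_eq2_refl _) _.
by rewrite -heis0; apply: iota_heis00.
Qed.

Lemma iota_sum_points (S : {set 'I_6}) :
  iota (xC (\sum_(n in S) grey_dual_basis n)) =L
  \sum_(n in S) point_vec R (mog ord0 n).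
Proof.
elim/big_ind2: _ => [|d u e v du ev|n _]; last exact: iota_point.
  by rewrite -heis0; apply: iota_heis00.
rewrite -(Qx_mulC HQ); apply: leech_eq2_trans (leech_isoM Hiota _ _) _.
exact: leech_eq2D.
Qed.

(** [tilde_x h] involves the partly unknown theta(h), so that [x_h] is used
    instead, of normal form (h, theta(h)); its difference to (h, 0) is covered
    by [compatible_cocode]. The element [x_h] commutes with all [x_epsilon],
    epsilon grey, and conjugation by xi_g multiplies it by [tilde_x e], where
    e is the union of the four columns that meet h. There
    theta(e) = 3 gamma(e). *)
Lemma compatible_coloured4 v (Hv : (v <= hexacode_mx)%MS) :
  #|hexa_supp v| = 4%N -> compatible (coloured_word Hv) 0.
Proof.
move=> S4; set h := coloured_word Hv; set S := hexa_supp v in S4 *.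
have even_S : ~~ odd #|S| by rewrite S4.
have act_d : act_delta h (theta' h) = theta' h.
  rewrite /act_delta row0_coloured ?coloured_wordP // flip0 F2comb0.
  exact: addr0.
have h8 : iota (xP (h, 0)) =L code_vec R h.
  have h_card : card24 h = 8%N.
    by rewrite (card24_coloured_word Hv : _ = (2 * #|S|)%N) S4.
  by apply: (leech_iso_code0 Hiota); rewrite /= h_card.
suff comp_h : compatible h (theta' h).
  rewrite -(addr0 h) -(addcocodexx (theta' h)).
  exact: compatibleD comp_h (compatible_cocode _).
rewrite /compatible /act /act_code act_d grey_coord_theta' flipK.
rewrite heis_xP -[X in heis _ X]addr0.
apply: leech_eq2_trans (iota_heisD _ _ _ _) _; rewrite heis_xP.
apply: leech_eq2_trans (leech_eq2_xi24 (leech_eq2_sym h8)).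
apply: leech_eq2_trans (coloured_xi24 R Hv S4); apply: leech_eq2D => //.
rewrite -/(column_word S) /heis txE xC0 mulg1.
apply: leech_eq2_trans (leech_isoM Hiota _ _) _; apply: leech_eq2D.
  apply: (leech_iso_code0 Hiota); rewrite /= card24_column_word //.
  by rewrite S4.
rewrite (theta'_column_word S4); exact: iota_sum_points.
Qed.

(** The multiples of the generators of the hexacode have weight 4 or 0. *)
Lemma compatible_coloured v (Hv : (v <= hexacode_mx)%MS) :
  compatible (coloured_word Hv) 0.
Proof.
have /submxP[a Da] := Hv.
have Hr i := hexacode_rowP i (a 0 i).
have -> : coloured_word Hv = \sum_i coloured_word (Hr i).
  apply: val_inj; rewrite /= (big_morph codeword codewordD erefl) /=.
  by rewrite {1}Da mulmx_sum_row (big_morph hexa_lift hexa_liftD hexa_lift0).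
elim/big_ind: _ => [|d e cd ce|i _]; first exact: compatible00.
  by rewrite -(addr0 0); apply: compatibleD.
have [ai0 | nz_ai] := eqVneq (a 0 i) 0; last first.
  exact/compatible_coloured4/hexacode_row_weight.
suff -> : coloured_word (Hr i) = 0 by apply: compatible00.
by apply: val_inj; rewrite /= ai0 scale0r hexa_lift0.
Qed.

Lemma act_compatible d delta : compatible d delta.
Proof.
rewrite -(addr0 d) -(add0r delta).
apply: compatibleD (compatible_cocode delta).
have [a [v [Hv ->]]] := golay_decomp d.
rewrite -(addr0 0); apply: compatibleD (compatible_coloured Hv).
rewrite F2comb_supp; elim/big_ind: _ => [|e f ce cf|n _].
- exact: compatible00.
- by rewrite -(addr0 0); apply: compatibleD.
exact: compatible_grey_basis.
Qed.

Lemma xi_same_action : same_action rho iota xi (xi_24 R).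
Proof.
move=> q r; have [d [delta [a ->]]] := heisP q.
have [b ->] := xi_conj d delta a; move/rho_inj <-.
apply: leech_eq2_trans (iota_zX _ _) _.
apply: leech_eq2_trans (act_compatible d delta) _.
exact/leech_eq2_xi24/leech_eq2_sym/iota_zX.
Qed.

End Representation.

End Extraspecial.

Theorem theorem9p10 (R : realType)
    (theta : code -> code -> 'F_2) (theta' : code -> cocode)
    (Htheta : parker_cocycle theta theta')
    (gT : finGroupType) (xP : parker_loop -> gT) (xC : cocode -> gT)
    (HQ : is_Qx theta xP xC)
    (rho : mx_representation R [set: gT] (2 ^ 12)%N)
    (rho_faithful : mx_faithful rho) (rho_irr : mx_irreducible rho)
    (B : 'M[R]_(2 ^ 12)%N) (B_euclidean : euclidean B)
    (B_invariant : forall q : gT, orthogonal_for B (rho q))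
    (iota : gT -> 'rV[R]_24) (Hiota : leech_iso xP xC iota) :
  [/\ in_G4096 B rho iota (xi theta' xP xC rho),
      in_G24 (xi_24 R)
    & in_Gx0 B rho iota (xi theta' xP xC rho *t xi_24 R)].
Proof.
have dim_gt1 : (1 < 2 ^ 12)%N by rewrite (ltn_exp2l 0).
have same := xi_same_action Htheta HQ dim_gt1 rho_faithful rho_irr Hiota.
have norm := xi_normalizes Htheta HQ dim_gt1 rho_faithful rho_irr.
have orth := xi_orthogonal Htheta HQ dim_gt1 rho_faithful rho_irr B_invariant.
have G24 := in_G24_xi24 R.
have G4096 : in_G4096 B rho iota (xi theta' xP xC rho).
  by split; [split | exists (xi_24 R)].
split=> //; by exists (xi theta' xP xC rho), (xi_24 R).
Qed.
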